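(* Let $\mathcal L$ be a complex simple Lie algebra of type $A_n$ ($n\ge3$), $D_n$ ($n\ge4$) or $E_n$ ($n\in\{6,7,8\}$), and let $\mathcal A\subseteq S^2(\mathcal L)$, the projection $v\mapsto\overline v$, the product $\bullet$ and the form $B$ be as in the context. Consider the bilinear maps $$\ast\colon\mathcal A\times\mathcal A\to\mathcal A\colon(v,w)\mapsto\overline{v\bullet w},\qquad \mathcal B\colon\mathcal A\times\mathcal A\to\mathbb C\colon(v,w)\mapsto B(v,w).$$ Then $(\mathcal A,\ast,\mathcal B)$ is a Frobenius algebra for $\mathcal L$.
   Context: Let $h_\alpha$ be the coroots with respect to a Cartan subalgebra, $e_\alpha$ root vectors of a Chevalley basis, $\omega$ the highest root with respect to a base, and $\kappa$ the rescaled Killing form with $\kappa(h_\alpha,h_\alpha)=2$ for all roots $\alpha$. The symmetric square $S^2(\mathcal L)$ is an $\mathcal L$-module via $\ell\cdot\ell_1\ell_2=[\ell,\ell_1]\ell_2+\ell_1[\ell,\ell_2]$, with bilinear product and form $$\ell_1\ell_2\bullet\ell_3\ell_4=\tfrac14(\kappa(\ell_1,\ell_3)\ell_2\ell_4+\kappa(\ell_1,\ell_4)\ell_2\ell_3+\kappa(\ell_2,\ell_3)\ell_1\ell_4+\kappa(\ell_2,\ell_4)\ell_1\ell_3),$$ $$B(\ell_1\ell_2,\ell_3\ell_4)=\tfrac12(\kappa(\ell_1,\ell_3)\kappa(\ell_2,\ell_4)+\kappa(\ell_1,\ell_4)\kappa(\ell_2,\ell_3)).$$ $\mathcal V$ is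 the $\mathcal L$-submodule of $S^2(\mathcal L)$ generated by $e_\omega e_\omega$ ($B$ restricts to a non-degenerate form on $\mathcal V$), $\mathcal A=\{v\mid B(v,w)=0\ \forall w\in\mathcal V\}$, and $v\mapsto\overline v$ is the orthogonal projection $S^2(\mathcal L)\to\mathcal A$. A Frobenius algebra $(V,\ast,\langle,\rangle)$ is a vector space with a bilinear product and a non-degenerate symmetric bilinear form such that $u\ast v=v\ast u$ and $\langle u\ast v,w\rangle=\langle u,v\ast w\rangle$ for all $u,v,w$. It is a Frobenius algebra for $\mathcal L$ if $V$ is an $\mathcal L$-module and product and form are $\mathcal L$-equivariant: $\ell\cdot(v\ast w)=(\ell\cdot v)\ast w+v\ast(\ell\cdot w)$ and $\langle\ell\cdot v,w\rangle+\langle v,\ell\cdot w\rangle=0$. *)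

(* Defs.v *)
From HB Require Import structures.
From mathcomp Require Import all_boot all_order all_algebra sesquilinear.
From mathcomp Require Import complex.
From mathcomp Require Import boolp reals.

Set Implicit Arguments.
Unset Strict Implicit.
Unset Printing Implicit Defensive.

Import GRing.Theory Num.Theory.
Import passmx.
Local Open Scope ring_scope.

HB.mixin Record Vector_isLieAlgebra (F : fieldType) L of Vector F L := {
  lie : L -> L -> L;
  lie_linearl : forall y : L, linear (lie^~ y);
  lie_linearr : forall x : L, linear (lie x);
  liexx : forall x : L, lie x x = 0;
  lie_jacobi : forall x y z : L,
    lie x (lie y z) + lie y (lie z x) + lie z (lie x y) = 0
}.

#[short(type="lieAlgType")]
HB.structure Definition LieAlgebra (F : fieldType) :=
  {L of Vector_isLieAlgebra F L & Vector F L}.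

HB.instance Definition _ (F : fieldType) (L : lieAlgType F) :=
  bilinear_isBilinear.Build F L L L _ _ (@lie F L)
    (@lie_linearl F L, @lie_linearr F L).
HB.instance Definition _ (F : fieldType) (L : lieAlgType F) (x : L) :=
  GRing.isLinear.Build F L L _ (lie x) (lie_linearr x).

Section LieAlgebra.
Variables (F : fieldType) (L : lieAlgType F).
Implicit Types (x y : L) (U V H I : {vspace L}).

Definition ad x : 'End(L) := linfun (lie x).

Definition killing x y : F :=
  \tr (mxof (vbasis {:L}) (vbasis {:L}) (ad x \o ad y)%VF).

Definition rescaled_killing (c : F) x y : F := c * killing x y.

Definition lie_prod U V : {vspace L} :=
  <<[seq lie x y | x <- vbasis U, y <- vbasis V]>>%VS.

Definition lie_ideal I := forall x y, y \in I -> lie x y \in I.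

Definition simple_lie :=
  (exists x y, lie x y != 0)
  /\ forall I, lie_ideal I -> I = 0%VS \/ I = fullv.

Definition cartan_subalgebra H :=
  [/\ (lie_prod H H <= H)%VS,
      exists k, iter k (lie_prod H) H = 0%VS
    & forall x, (forall y, y \in H -> lie x y \in H) -> x \in H].

Lemma adE x y : ad x y = lie x y. Proof. exact: lfunE. Qed.

Lemma ad_is_linear : linear ad.
Proof.
move=> a x y; apply/lfunP => z.
by rewrite add_lfunE scale_lfunE !adE linearPl.
Qed.

Lemma killingC x y : killing x y = killing y x.
Proof.
have vB := vbasisP {:L}.
by rewrite /killing !(mxof_comp _ _ vB) mxtrace_mulC.
Qed.

Lemma killing_linearl y : scalar (killing^~ y).
Proof.
move=> a x x'; rewrite /killing ad_is_linear comp_lfunDl -comp_lfunZl.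
by rewrite linearP /= mxtraceD mxtraceZ.
Qed.

Lemma rescaled_killingC c x y : rescaled_killing c x y = rescaled_killing c y x.
Proof. by rewrite /rescaled_killing killingC. Qed.

Lemma rescaled_killing_linearl c y : scalar ((rescaled_killing c)^~ y).
Proof.
by move=> a x x'; rewrite /rescaled_killing killing_linearl mulrDr mulrCA.
Qed.

Lemma rescaled_killing_linearr c x : scalar (rescaled_killing c x).
Proof.
move=> a y y'; rewrite !(rescaled_killingC c x).
exact: rescaled_killing_linearl.
Qed.

End LieAlgebra.

HB.instance Definition _ (F : fieldType) (L : lieAlgType F) (c : F) :=
  bilinear_isBilinear.Build F L L F *%R (idfun \; *%R) (@rescaled_killing F L c)
    (@rescaled_killing_linearl F L c, @rescaled_killing_linearr F L c).

Lemma rescaled_killing_sym (F : fieldType) (L : lieAlgType F) (c : F) (x y : L) :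
  rescaled_killing c x y = (-1) ^+ false * idfun (rescaled_killing c y x).
Proof. by rewrite expr0 mul1r rescaled_killingC. Qed.

HB.instance Definition _ (F : fieldType) (L : lieAlgType F) (c : F) :=
  isHermitianSesquilinear.Build F L false idfun (@rescaled_killing F L c)
    (@rescaled_killing_sym F L c).


(* In characteristic 0, [S^2(L)] is realised as the space of symmetric tensors
   in [L (x) L], the product [x y] being [(x (x) y + y (x) x) / 2]; tensors are
   written as matrices of coordinates with respect to a basis of [L]. Lemmas
   [s2liftE] and [s2_ext] are the universal property of [S^2(L)]. *)

Lemma linear_comb (R : pzRingType) (U V : lmodType R) (f : U -> V) :
    linear f -> forall (I : Type) (r : seq I) (c : I -> R) (u : I -> U),
  f (\sum_(i <- r) c i *: u i) = \sum_(i <- r) c i *: f (u i).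
Proof.
move=> fl I r c u; elim: r => [|i r IHr]; last by rewrite !big_cons fl IHr.
by rewrite !big_nil; have := fl (-1) 0 0; rewrite scaler0 add0r scaleN1r addNr.
Qed.

Section SymmetricSquare.
Variables (F : numFieldType) (L : vectType F).
Implicit Types (x y : L) (W : vectType F).

Let b := vbasis {:L}.

Definition tensor x y : 'M[F]_(\dim {:L}) := (rVof b x)^T *m rVof b y.

Definition symmetric_tensors : {vspace 'M[F]_(\dim {:L})} :=
  lker (linfun (@trmx F (\dim {:L}) (\dim {:L})) - \1%VF).

Definition sym2 : predArgType := subvs_of symmetric_tensors.

HB.instance Definition _ := Vector.on sym2.

Definition s2val (u : sym2) : 'M[F]_(\dim {:L}) := vsval u.

Lemma s2val_linear : linear s2val. Proof. exact: linearP. Qed.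

HB.instance Definition _ :=
  GRing.isLinear.Build F sym2 'M[F]_(\dim {:L}) _ s2val s2val_linear.

Lemma s2val_inj : injective s2val. Proof. exact: val_inj. Qed.

Definition s2mul x y : sym2 :=
  vsproj symmetric_tensors (2^-1 *: (tensor x y + tensor y x)).

(* For [f] symmetric bilinear, this is the linear map with [x y |-> f x y]. *)
Definition s2lift W (f : L -> L -> W) (u : sym2) : W :=
  \sum_i \sum_j s2val u i j *: f b`_i b`_j.

Lemma s2mulC x y : s2mul x y = s2mul y x.
Proof. by rewrite /s2mul addrC. Qed.

Lemma tensor_linearl y : linear (tensor^~ y).
Proof.
by move=> a x x'; rewrite /tensor linearP /= linearP /= mulmxDl -scalemxAl.
Qed.

Lemma tensor_linearr x : linear (tensor x).
Proof. by move=> a y y'; rewrite /tensor linearP /= mulmxDr -scalemxAr. Qed.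

Lemma s2mul_linearl y : linear (s2mul^~ y).
Proof.
move=> a x x'; rewrite /s2mul tensor_linearl tensor_linearr.
rewrite -[RHS](linearP (vsproj symmetric_tensors)); congr (vsproj _ _).
rewrite addrACA scalerDr; congr (_ + _).
by rewrite -scalerDr !scalerA mulrC.
Qed.

Lemma s2mul_linearr x : linear (s2mul x).
Proof. by move=> a y y'; rewrite !(s2mulC x) s2mul_linearl. Qed.

Lemma s2lift_linear W (f : L -> L -> W) : linear (s2lift f).
Proof.
move=> a u v; rewrite /s2lift scaler_sumr -big_split; apply: eq_bigr => i _.
rewrite scaler_sumr -big_split; apply: eq_bigr => j _.
by rewrite s2val_linear !mxE scalerDl scalerA.
Qed.

Lemma mem_symmetric_tensors (M : 'M[F]_(\dim {:L})) :
  (M \in symmetric_tensors) = (M^T == M).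
Proof. by rewrite memv_ker !lfun_simp subr_eq0. Qed.

Lemma s2val_s2mul x y : s2val (s2mul x y) = 2^-1 *: (tensor x y + tensor y x).
Proof.
rewrite /s2val vsprojK // mem_symmetric_tensors linearZ linearD /= !trmx_mul !trmxK.
by rewrite addrC.
Qed.

Lemma s2lift_sum W (f : L -> L -> W) x y :
    (forall z, linear (f^~ z)) -> (forall z, linear (f z)) ->
  f x y = \sum_i \sum_j tensor x y i j *: f b`_i b`_j.
Proof.
move=> fl fr.
rewrite {1}(coord_vbasis (memvf x)) (linear_comb (fl y)); apply: eq_bigr => i _.
rewrite {1}(coord_vbasis (memvf y)) (linear_comb (fr _)) scaler_sumr.
by apply: eq_bigr => j _; rewrite scalerA !mxE big_ord1 !mxE.
Qed.

Lemma s2liftE W (f : L -> L -> W) x y :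
    (forall z, linear (f^~ z)) -> (forall z, linear (f z)) ->
    (forall z t, f z t = f t z) ->
  s2lift f (s2mul x y) = f x y.
Proof.
move=> fl fr fC; rewrite /s2lift s2val_s2mul.
transitivity (2^-1 *: (f x y + f y x)); last first.
  by rewrite (fC y) -mulr2n -scaler_nat scalerA mulVf ?scale1r // pnatr_eq0.
rewrite (s2lift_sum x y fl fr) (s2lift_sum y x fl fr) -big_split scaler_sumr.
apply: eq_bigr => i _; rewrite -big_split scaler_sumr; apply: eq_bigr => j _ /=.
by rewrite 2!mxE -scalerDl scalerA.
Qed.

Lemma s2_decomp (u : sym2) : u = s2lift s2mul u.
Proof.
apply: s2val_inj; rewrite /s2lift linear_sum /=.
have uT : (s2val u)^T = s2val u by apply/eqP; rewrite -mem_symmetric_tensors subvsP.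
have uE : s2val u = \sum_i \sum_j s2val u i j *: tensor b`_i b`_j.
  rewrite {1}[s2val u]matrix_sum_delta; apply: eq_bigr => i _.
  apply: eq_bigr => j _; congr (_ *: _).
  by rewrite /tensor !(rVofE (vbasisP _)) trmx_delta mul_delta_mx.
have uE' : s2val u = \sum_i \sum_j s2val u i j *: tensor b`_j b`_i.
  rewrite {1}uE exchange_big; apply: eq_bigr => i _; apply: eq_bigr => j _ /=.
  by rewrite -{1}uT mxE.
transitivity (2^-1 *: (s2val u + s2val u)).
  by rewrite -mulr2n -scaler_nat scalerA mulVf ?scale1r // pnatr_eq0.
rewrite [X in X + _]uE [X in _ + X]uE' -big_split scaler_sumr; apply: eq_bigr => i _.
rewrite linear_sum -big_split scaler_sumr; apply: eq_bigr => j _.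
by rewrite [RHS]linearZ /= s2val_s2mul -scalerDr !scalerA mulrC.
Qed.

Lemma s2_ext W (g h : sym2 -> W) : linear g -> linear h ->
  (forall x y, g (s2mul x y) = h (s2mul x y)) -> g =1 h.
Proof.
move=> gl hl gh u.
rewrite [u]s2_decomp /s2lift pair_bigA /= (linear_comb gl) (linear_comb hl).
by apply: eq_bigr => p _; rewrite gh.
Qed.

End SymmetricSquare.

HB.instance Definition _ (F : numFieldType) (L W : vectType F) (f : L -> L -> W) :=
  GRing.isLinear.Build F (sym2 L) W _ (s2lift f) (s2lift_linear f).
Section Linearity.
Variables (R : comPzRingType) (U W : lmodType R).

Lemma linear_add (f g : U -> W) :
  linear f -> linear g -> linear (fun x => f x + g x).
Proof. by move=> fl gl a x y; rewrite fl gl scalerDr addrACA. Qed.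

Lemma linear_scale c (f : U -> W) : linear f -> linear (fun x => c *: f x).
Proof. by move=> fl a x y; rewrite fl scalerDr !scalerA mulrC. Qed.

Lemma scalar_scale (f : U -> R) (w : W) : scalar f -> linear (fun x => f x *: w).
Proof. by move=> fl a x y; rewrite fl scalerDl scalerA. Qed.

Lemma scale_const c (f : U -> R) :
  scalar f -> linear (fun x => c * f x : R^o).
Proof. by move=> fl a x y; rewrite fl mulrDr mulrCA. Qed.

End Linearity.

Section SymmetricSquareForms.
Variables (F : numFieldType) (L : vectType F) (kappa : {symmetric L}).
Implicit Types (x y : L) (u v w : sym2 L).

Definition s2prod u v : sym2 L :=
  s2lift (fun x1 x2 =>
    s2lift (fun x3 x4 =>
      4^-1 *: (kappa x1 x3 *: s2mul x2 x4 + kappa x1 x4 *: s2mul x2 x3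
               + kappa x2 x3 *: s2mul x1 x4 + kappa x2 x4 *: s2mul x1 x3)) v) u.

Definition s2form u v : F :=
  s2lift (W := F^o) (fun x1 x2 =>
    s2lift (W := F^o) (fun x3 x4 =>
      2^-1 * (kappa x1 x3 * kappa x2 x4 + kappa x1 x4 * kappa x2 x3)) v) u.

Let kC x y : kappa x y = kappa y x.
Proof. by have := hermC kappa x y; rewrite expr0 mul1r. Qed.

Lemma s2lift_param (U W : vectType F) (f : U -> L -> L -> W) w :
  (forall x y, linear (fun t : U => f t x y)) ->
  linear (fun t : U => s2lift (f t) w).
Proof.
move=> fl a s t; rewrite /s2lift scaler_sumr -big_split; apply: eq_bigr => i _.
rewrite scaler_sumr -big_split; apply: eq_bigr => j _.
by rewrite fl /= scalerDr !scalerA mulrC.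
Qed.

Lemma eq_s2lift (W : vectType F) (f g : L -> L -> W) w :
  f =2 g -> s2lift f w = s2lift g w.
Proof.
by move=> fg; apply: eq_bigr => i _; apply: eq_bigr => j _; rewrite fg.
Qed.

Let kl y : scalar (kappa^~ y). Proof. by move=> a x x'; rewrite linearPl. Qed.
Let kr x : scalar (kappa x). Proof. by move=> a y y'; rewrite !(kC x) kl. Qed.

Local Ltac bilin := repeat first
  [ exact: kl | exact: kr | exact: s2mul_linearl | exact: s2mul_linearr
  | exact: s2lift_linear
  | (apply: s2lift_param => ? ?) | apply: (@linear_add F L F^o) | apply: linear_add
  | apply: scale_const
  | apply: scalar_scale | apply: linear_scale ].

Lemma s2prod_linearl v : linear (s2prod^~ v).
Proof. exact: s2lift_linear. Qed.

Lemma s2prod_linearr u : linear (s2prod u).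
Proof. by rewrite /s2prod; bilin. Qed.

Lemma s2prodE x1 x2 x3 x4 :
  s2prod (s2mul x1 x2) (s2mul x3 x4) =
    4^-1 *: (kappa x1 x3 *: s2mul x2 x4 + kappa x1 x4 *: s2mul x2 x3
             + kappa x2 x3 *: s2mul x1 x4 + kappa x2 x4 *: s2mul x1 x3).
Proof.
rewrite /s2prod s2liftE; [|by move=> z; bilin|by move=> z; bilin|].
  rewrite s2liftE //; [by move=> z; bilin|by move=> z; bilin|].
  move=> z t; congr (_ *: _).
  by rewrite -addrA [X in X + _]addrC [X in _ + X]addrC addrA.
move=> z t; apply: eq_s2lift => ? ?; congr (_ *: _).
by rewrite -addrA [LHS]addrC !addrA.
Qed.

Lemma s2form_linearl v : scalar (s2form^~ v).
Proof. exact: (s2lift_linear (W := F^o)). Qed.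

Lemma s2formE x1 x2 x3 x4 :
  s2form (s2mul x1 x2) (s2mul x3 x4) =
    2^-1 * (kappa x1 x3 * kappa x2 x4 + kappa x1 x4 * kappa x2 x3).
Proof.
rewrite /s2form s2liftE; [|by move=> z; bilin|by move=> z; bilin|].
  rewrite s2liftE //; [by move=> z; bilin|by move=> z; bilin|].
  by move=> z t; congr (_ * _); rewrite addrC.
move=> z t; apply: eq_s2lift => ? ?; congr (_ * _).
by rewrite addrC; congr (_ + _); rewrite mulrC.
Qed.

Lemma s2form_linearr u : scalar (s2form u).
Proof.
have bilin_form : linear (s2form u : sym2 L -> F^o) by rewrite /s2form; bilin.
exact: bilin_form.
Qed.

Lemma s2formC u v : s2form u v = s2form v u.
Proof.
apply: (s2_ext (W := F^o) (g := s2form^~ v) (h := s2form v)) => [||x y].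
- exact: s2form_linearl.
- exact: s2form_linearr.
apply: (s2_ext (W := F^o) (g := s2form _) (h := s2form^~ _)) => [||z t].
- exact: s2form_linearr.
- exact: s2form_linearl.
rewrite !s2formE !(kC z) !(kC t) [kappa x t * _]mulrC.
by congr (_ * (_ + _)).
Qed.

End SymmetricSquareForms.

HB.instance Definition _ (F : numFieldType) (L : vectType F)
    (kappa : {symmetric L}) :=
  bilinear_isBilinear.Build F (sym2 L) (sym2 L) F *%R (idfun \; *%R)
    (s2form kappa) (s2form_linearl kappa, s2form_linearr kappa).

Lemma s2form_sym (F : numFieldType) (L : vectType F) (kappa : {symmetric L})
    (u v : sym2 L) :
  s2form kappa u v = (-1) ^+ false * idfun (s2form kappa v u).
Proof. by rewrite expr0 mul1r s2formC. Qed.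

HB.instance Definition _ (F : numFieldType) (L : vectType F)
    (kappa : {symmetric L}) :=
  isHermitianSesquilinear.Build F (sym2 L) false idfun (s2form kappa)
    (s2form_sym kappa).

Section SymmetricSquareAction.
Variables (F : numFieldType) (L : lieAlgType F).
Implicit Types l x y : L.

Definition s2act l : sym2 L -> sym2 L :=
  s2lift (fun x y => s2mul (lie l x) y + s2mul x (lie l y)).

Lemma s2actE l x y :
  s2act l (s2mul x y) = s2mul (lie l x) y + s2mul x (lie l y).
Proof.
rewrite /s2act s2liftE // => [z|z|z t].
- apply: linear_add; last exact: s2mul_linearl.
  by move=> a t t'; rewrite linearP s2mul_linearl.
- apply: linear_add; first exact: s2mul_linearr.
  by move=> a t t'; rewrite linearP s2mul_linearr.
by rewrite addrC (s2mulC z) (s2mulC _ t).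
Qed.

End SymmetricSquareAction.

Section Roots.
Variables (F : fieldType) (L : lieAlgType F) (H : {vspace L}) (n : nat).

Definition hdual : vectType F := 'Hom(subvs_of H, F^o).

Definition hpair (alpha : hdual) (t : subvs_of H) : F := alpha t.

Implicit Types (alpha beta : hdual) (x : L).
Implicit Types (Delta : 'I_n -> hdual) (h : hdual -> subvs_of H) (e : hdual -> L).

Definition in_root_space alpha x :=
  forall t : subvs_of H, lie (vsval t) x = hpair alpha t *: x.

Definition is_root alpha :=
  alpha != 0 /\ exists2 x, x != 0 & in_root_space alpha x.

(* The coroot of [alpha] is the element [t] of [[L_alpha, L_(-alpha)]] such that
   [alpha t = 2]; as root spaces are lines, that space consists of brackets. *)
Definition is_coroot alpha (t : subvs_of H) :=
  (exists x y, [/\ in_root_space alpha x, in_root_space (- alpha) y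
                 & lie x y = vsval t])
  /\ hpair alpha t = 2%:R.

Definition nat_comb Delta alpha :=
  exists k : 'I_n -> nat, alpha = \sum_i Delta i *+ k i.

Definition is_base Delta :=
  [/\ forall i, is_root (Delta i),
      basis_of fullv [seq Delta i | i <- enum 'I_n]
    & forall beta, is_root beta -> nat_comb Delta beta \/ nat_comb Delta (- beta)].

Definition is_highest_root Delta omega :=
  is_root omega /\ forall beta, is_root beta -> nat_comb Delta (omega - beta).

(* The vectors [e alpha] ([alpha] a root) and [h (Delta i)] form a Chevalley
   basis; the values of [h] and [e] away from the roots are irrelevant. That the
   structure constants are integers is a consequence. *)
Definition is_chevalley_basis Delta h e :=
  [/\ exists Phi : seq hdual,
        [/\ uniq Phi, forall alpha, alpha \in Phi <-> is_root alpha
          & basis_of fullv ([seq vsval (h (Delta i)) | i <- enum 'I_n]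
                            ++ [seq e alpha | alpha <- Phi])],
      forall alpha, is_root alpha -> in_root_space alpha (e alpha),
      forall alpha, is_root alpha -> lie (e alpha) (e (- alpha)) = vsval (h alpha)
    & exists N : hdual -> hdual -> F, forall alpha beta,
        is_root alpha -> is_root beta -> is_root (alpha + beta) ->
        lie (e alpha) (e beta) = N alpha beta *: e (alpha + beta)
        /\ N alpha beta = - N (- alpha) (- beta)].

End Roots.

Inductive ade := TypeA | TypeD | TypeE.

Definition ade_rank (T : ade) (n : nat) : bool :=
  match T with
  | TypeA => (3 <= n)%N
  | TypeD => (4 <= n)%N
  | TypeE => (6 <= n <= 8)%N
  end.

(* Edges [i -- j] with [i < j] of the Dynkin diagram on [0, ..., n - 1], with
   Bourbaki's labelling shifted by one. *)
Definition ade_edge (T : ade) (n i j : nat) : bool :=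
  match T with
  | TypeA => j == i.+1
  | TypeD => if j == n.-1 then i == n - 3 else j == i.+1
  | TypeE => if (i < 2)%N then j == i.+2 else j == i.+1
  end%N.

Definition cartan_matrix (T : ade) (n : nat) (i j : nat) : int :=
  if i == j then 2 else
  if ade_edge T n i j || ade_edge T n j i then -1 else 0.

Section Modules.
Variables (F : fieldType) (L : lieAlgType F).

Record is_lie_module (V : lmodType F) (act : L -> V -> V) : Prop := {
  lact_linearl : forall v, linear (act^~ v);
  lact_linearr : forall l, linear (act l);
  lact_lie : forall l m v, act (lie l m) v = act l (act m v) - act m (act l v)
}.

Definition is_submodule (V : vectType F) (act : L -> V -> V) (U : {vspace V}) :=
  forall l u, u \in U -> act l u \in U.

Definition is_generated_submodule (V : vectType F) (act : L -> V -> V) (v : V)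
    (U : {vspace V}) :=
  [/\ is_submodule act U, v \in U
    & forall U', is_submodule act U' -> v \in U' -> (U <= U')%VS].

(* Restriction of the action to [U]; meaningful when [U] is a submodule, in which
   case [vsproj U] only changes the type. *)
Definition subact (V : vectType F) (act : L -> V -> V) (U : {vspace V})
    (l : L) (u : subvs_of U) : subvs_of U :=
  vsproj U (act l (vsval u)).

Record is_frobenius_algebra (V : lmodType F) (mul : V -> V -> V)
    (form : V -> V -> F) : Prop := {
  frob_mul_linearl : forall v, linear (mul^~ v);
  frob_mul_linearr : forall u, linear (mul u);
  frob_form_linearl : forall v, scalar (form^~ v);
  frob_form_linearr : forall u, scalar (form u);
  frob_form_sym : forall u v, form u v = form v u;
  frob_form_nondeg : forall u, (forall v, form u v = 0) -> u = 0;
  frob_mulC : forall u v, mul u v = mul v u;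
  frob_assoc : forall u v w, form (mul u v) w = form u (mul v w)
}.

Record is_frobenius_algebra_for (V : lmodType F) (act : L -> V -> V)
    (mul : V -> V -> V) (form : V -> V -> F) : Prop := {
  frobL_frobenius : is_frobenius_algebra mul form;
  frobL_module : is_lie_module act;
  frobL_mul : forall l v w, act l (mul v w) = mul (act l v) w + mul v (act l w);
  frobL_form : forall l v w, form (act l v) w + form v (act l w) = 0
}.

Lemma generated_submodule_exists (V : vectType F) (act : L -> V -> V) (v : V) :
  exists U, is_generated_submodule act v U.
Proof.
have [d] := ubnP (\dim (fullv : {vspace V})).
have: is_submodule act fullv by move=> l u _; apply: memvf.
have: v \in fullv by apply: memvf.
elim: d {1 2 3}fullv => // d IHd U Uv Us dU.
have [[U' [U's U'v nUU']]|noU'] :=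
  EM (exists U', [/\ is_submodule act U', v \in U' & ~~ (U <= U')%VS]).
  apply: (IHd (U :&: U')%VS); first by rewrite memv_cap Uv.
    by move=> l u; rewrite !memv_cap => /andP[/Us-> /U's->].
  rewrite -ltnS; apply: leq_trans dU; rewrite ltnS ltn_neqAle dimvS ?capvSl //.
  rewrite andbT; apply: contra nUU' => /eqP dUU'; apply/capv_idPl/eqP.
  by rewrite eqEdim capvSl dUU' leqnn.
exists U; split=> // U' U's U'v; apply/negP => /negP nUU'.
by apply: noU'; exists U'.
Qed.

End Modules.

Section TheAlgebra.
Variables (F : numFieldType) (L : lieAlgType F).
Variables (kappa : {symmetric L}) (V : {vspace sym2 L}).

Definition Aspace : {vspace sym2 L} := orthov (s2form kappa) V.

(* [S^2(L)] is the orthogonal sum of [A] and [V], so that the orthogonal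
   projection onto [A] is the projection onto [A] along [V]. *)
Definition Aproj : 'End(sym2 L) := daddv_pi Aspace V.

Definition Aprod (v w : subvs_of Aspace) : subvs_of Aspace :=
  vsproj Aspace (Aproj (s2prod kappa (vsval v) (vsval w))).

Definition Aform (v w : subvs_of Aspace) : F := s2form kappa (vsval v) (vsval w).

Lemma mem_AspaceP (v : sym2 L) :
  reflect {in V, forall w, s2form kappa v w = 0} (v \in Aspace).
Proof. exact: mem_orthovP. Qed.

Lemma vsval_Aprod v w :
  vsval (Aprod v w) = Aproj (s2prod kappa (vsval v) (vsval w)).
Proof. by rewrite /Aprod vsprojK // memv_pi. Qed.

End TheAlgebra.

(* Main.v *)
(* Once [B] is non-degenerate on [S^2(L)] and [A] meets [V] trivially, [S^2(L)]
   is the direct sum of the submodules [A] and [V], so the projection onto [A] is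
   equivariant and self-adjoint, and the Frobenius identities descend from
   [S^2(L)] to [A].
   That [A] meets [V] trivially is proved by unitarity instead of complete
   reducibility. Since all roots satisfy [kappa (h_a, h_a) = 2], [h_a] is the
   [kappa]-dual of [a] and the structure constants [N a b] are [1] or [-1], so the
   antilinear map [sigma] with [h_a |-> - h_a] and [e_a |-> - e_(-a)] is an
   automorphism of [L] (conjugation with respect to the compact real form), and
   [- kappa (x, sigma y)] is a positive definite hermitian form. The induced
   conjugation [S] of [S^2(L)] preserves [V], because [e_(-omega)^4] maps
   [e_omega e_omega] to a multiple of [e_(-omega) e_(-omega)]; hence [r] in the
   radical of [V] gives [B (r, S r) = 0] and thus [r = 0]. *)

From HB Require Import structures.
Require Import Defs.
From mathcomp Require Import all_boot all_order all_algebra sesquilinear.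
From mathcomp Require Import complex reals boolp ring.

Set Implicit Arguments.
Unset Strict Implicit.
Unset Printing Implicit Defensive.

Import Order.TTheory GRing.Theory Num.Theory.
Import passmx.
Local Open Scope ring_scope.

(** * Modules and forms on the symmetric square *)

Section LinearFacts.
Variables (R : pzRingType) (U W : lmodType R) (f : U -> W).
Hypothesis fl : linear f.

Lemma linear_morphD x y : f (x + y) = f x + f y.
Proof. by have := fl 1 x y; rewrite !scale1r. Qed.

Lemma linear_morph0 : f 0 = 0.
Proof. by apply: (@addrI _ (f 0)); rewrite -linear_morphD !addr0. Qed.

Lemma linear_morphZ a x : f (a *: x) = a *: f x.
Proof. by have := fl a x 0; rewrite linear_morph0 !addr0. Qed.

Lemma linear_morphN x : f (- x) = - f x.
Proof. by rewrite -scaleN1r linear_morphZ scaleN1r. Qed.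

End LinearFacts.

Section LieModules.
Variables (F : fieldType) (L : lieAlgType F).
Implicit Types (l m x y : L).

Lemma lieDr x y z : lie x (y + z) = lie x y + lie x z.
Proof. exact: linear_morphD (lie_linearr x) _ _. Qed.
Lemma lieDl x y z : lie (x + y) z = lie x z + lie y z.
Proof. exact: linear_morphD (lie_linearl z) _ _. Qed.
Lemma lieZr a x y : lie x (a *: y) = a *: lie x y.
Proof. exact: linear_morphZ (lie_linearr x) _ _. Qed.
Lemma lieZl a x y : lie (a *: x) y = a *: lie x y.
Proof. exact: linear_morphZ (lie_linearl y) _ _. Qed.
Lemma lieNr x y : lie x (- y) = - lie x y.
Proof. exact: linear_morphN (lie_linearr x) _. Qed.
Lemma lieNl x y : lie (- x) y = - lie x y.
Proof. exact: linear_morphN (lie_linearl y) _. Qed.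
Lemma lie0r x : lie x 0 = 0.
Proof. exact: linear_morph0 (lie_linearr x). Qed.
Lemma lie0l x : lie 0 x = 0.
Proof. exact: linear_morph0 (lie_linearl x). Qed.

Lemma lieC x y : lie x y = - lie y x.
Proof.
apply/eqP; rewrite -addr_eq0; apply/eqP.
by have := liexx (x + y); rewrite lieDr !lieDl !liexx add0r addr0 addrC.
Qed.

Lemma lie_lie x y z : lie (lie x y) z = lie x (lie y z) - lie y (lie x z).
Proof.
rewrite lieC; apply/eqP; rewrite eq_sym -addr_eq0.
by rewrite [lie x z]lieC lieNr opprK lie_jacobi.
Qed.

(** [ad] turns [lie l x] into a commutator, and cyclicity of the trace then moves [ad l] to the
    other argument. *)
Lemma killing_inv l x y : killing (lie l x) y = - killing x (lie l y).
Proof.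
have vB := vbasisP {:L}.
have adlie (u v : L) : ad (lie u v) = ((ad u \o ad v) - (ad v \o ad u))%VF.
  by apply/lfunP => z; rewrite adE add_lfunE opp_lfunE !comp_lfunE !adE lie_lie.
rewrite /killing !adlie !(comp_lfunDl, comp_lfunDr, comp_lfunNl, comp_lfunNr).
rewrite linearB [in RHS]linearB /= [LHS]linearB [in RHS]linearB /=.
rewrite !(mxof_comp _ _ vB) opprB.
by rewrite !mulmxA; congr (_ - _); rewrite mxtrace_mulC mulmxA.
Qed.

Lemma rescaled_killing_inv c l x y :
  rescaled_killing c (lie l x) y = - rescaled_killing c x (lie l y).
Proof. by rewrite /rescaled_killing killing_inv mulrN. Qed.

End LieModules.

Section SymmetricSquareModule.
Variables (F : numFieldType) (L : lieAlgType F).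
Implicit Types (l m x y : L).

Lemma s2mulDl x y z : s2mul (x + y) z = s2mul x z + s2mul y z :> sym2 L.
Proof. exact: linear_morphD (s2mul_linearl z) _ _. Qed.
Lemma s2mulZl a x z : s2mul (a *: x) z = a *: s2mul x z :> sym2 L.
Proof. exact: linear_morphZ (s2mul_linearl z) _ _. Qed.
Lemma s2mulNl x z : s2mul (- x) z = - s2mul x z :> sym2 L.
Proof. exact: linear_morphN (s2mul_linearl z) _. Qed.

Lemma s2act_linear l : linear (@s2act _ L l).
Proof. exact: s2lift_linear. Qed.

Lemma s2actD l u v : s2act l (u + v : sym2 L) = s2act l u + s2act l v.
Proof. exact: linear_morphD (s2act_linear l) _ _. Qed.

Lemma s2actZ l a u : s2act l (a *: u : sym2 L) = a *: s2act l u.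
Proof. exact: linear_morphZ (s2act_linear l) _ _. Qed.

Lemma s2act_linearl u : linear ((@s2act _ L)^~ u).
Proof.
move=> a l m.
apply: (s2_ext (g := s2act (a *: l + m))
               (h := fun u => a *: s2act l u + s2act m u)) => [||x y].
- exact: s2act_linear.
- by apply: linear_add; first apply: linear_scale; apply: s2act_linear.
rewrite !s2actE !lieDl !lieZl !(s2mulC x) !s2mulDl !s2mulZl.
by rewrite scalerDr addrACA.
Qed.

Lemma s2act_module : is_lie_module (@s2act _ L).
Proof.
split=> [|l|l m v]; [exact: s2act_linearl | exact: s2act_linear |].
move: v; apply: (s2_ext (g := s2act _)
  (h := fun v => s2act l (s2act m v) - s2act m (s2act l v))) => [||x y].
- exact: s2act_linear.
- by move=> a u v; rewrite !s2act_linear scalerBr opprD addrACA.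
rewrite !s2actE !s2actD !s2actE !lie_lie (s2mulC x) !s2mulDl !s2mulNl !(s2mulC x).
rewrite !opprD !addrA.
(* The terms with one bracket on each factor cancel in the pairs [2*7] and [3*6]. *)
rewrite [RHS](ACl ((1*5)*(4*8)*(2*7)*(3*6))) /=.
by rewrite !subrr !addr0 addrA.
Qed.

End SymmetricSquareModule.

(** * Invariance, commutativity and associativity of the product and the form *)

Section InvariantForm.
Variables (F : numFieldType) (L : lieAlgType F) (kappa : {symmetric L}).
Hypothesis kappa_inv : forall l x y, kappa (lie l x) y = - kappa x (lie l y).
Implicit Types (l x y : L) (u v w : sym2 L).
Local Notation B := (s2form kappa).
Local Notation "u • v" := (s2prod kappa u v) (at level 40, left associativity).

Lemma kappaC x y : kappa x y = kappa y x.
Proof. by have := hermC kappa x y; rewrite expr0 mul1r. Qed.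

Lemma s2formDl u v w : B (u + v) w = B u w + B v w.
Proof.
exact: (linear_morphD (f := B^~ w : sym2 L -> F^o) (s2form_linearl kappa _)).
Qed.

Lemma s2formZl a u w : B (a *: u) w = (a * B u w)%R.
Proof.
exact: (linear_morphZ (f := B^~ w : sym2 L -> F^o) (s2form_linearl kappa _)).
Qed.

Lemma s2formDr u v w : B w (u + v) = B w u + B w v.
Proof. by rewrite !(s2formC kappa w) s2formDl. Qed.

(** Here and in the lemmas on the product below, linearity and [s2_ext] reduce the identity to
    products of two vectors. In this case [kappa_inv] makes the terms cancel in pairs. *)
Lemma s2form_inv l u v : B (s2act l u) v + B u (s2act l v) = 0.
Proof.
move: u; apply: (s2_ext (W := F^o) (g := fun u => B (s2act l u) v + B u (s2act l v))
                        (h := fun=> 0)) => [a u u'|a u u'|x y].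
- by rewrite s2act_linear !s2form_linearl /= scalerDr addrACA.
- by rewrite scaler0 addr0.
move: v; apply: (s2_ext (W := F^o) (g := fun v => B (s2act l _) v + B _ (s2act l v))
                        (h := fun=> 0)) => [a u u'|a u u'|z t].
- by rewrite s2act_linear !s2form_linearr /= scalerDr addrACA.
- by rewrite scaler0 addr0.
rewrite !s2actE s2formDl s2formDr !s2formE !kappa_inv.
ring.
Qed.

Lemma s2prodC u v : u • v = v • u.
Proof.
move: u; apply: (s2_ext (g := s2prod kappa ^~ v) (h := s2prod kappa v)) => [||x y].
- exact: s2prod_linearl.
- exact: s2prod_linearr.
move: v; apply: (s2_ext (g := s2prod kappa _) (h := s2prod kappa ^~ _)) => [||z t].
- exact: s2prod_linearr.
- exact: s2prod_linearl.
rewrite !s2prodE !(kappaC z) !(kappaC t) !(s2mulC y) !(s2mulC x).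
by congr (_ *: _); rewrite -!addrA; congr (_ + _); rewrite addrCA.
Qed.

Lemma s2prodDl u v w : (u + v) • w = u • w + v • w.
Proof. exact: linear_morphD (s2prod_linearl kappa w) _ _. Qed.

Lemma s2prodDr u v w : w • (u + v) = w • u + w • v.
Proof. exact: linear_morphD (s2prod_linearr kappa w) _ _. Qed.

(** On products of vectors, both sides are the same sum of eight terms, each with one value of
    [kappa] for every two of [u], [v], [w]. *)
Lemma s2prod_assoc u v w : B (u • v) w = B u (v • w).
Proof.
move: u; apply: (s2_ext (W := F^o) (g := fun u => B (u • v) w)
   (h := fun u => B u (v • w))) => [a u u'||x y].
- by rewrite s2prod_linearl s2form_linearl.
- exact: s2form_linearl.
move: v; apply: (s2_ext (W := F^o) (g := fun v => B (_ • v) w)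
   (h := fun v => B _ (v • w))) => [a u u'|a u u'|z t].
- by rewrite s2prod_linearr s2form_linearl.
- by rewrite s2prod_linearl s2form_linearr.
move: w; apply: (s2_ext (W := F^o) (g := fun w => B _ w)
   (h := fun w => B _ (_ • w))) => [|a u u'|p q].
- exact: s2form_linearr.
- by rewrite s2prod_linearr s2form_linearr.
rewrite !s2prodE [RHS]s2formC !s2formZl !s2formDl !s2formZl !s2formE.
rewrite !(kappaC _ x) !(kappaC _ y) !(kappaC _ z) !(kappaC _ t).
ring.
Qed.

Lemma s2prod_act l u v : s2act l (u • v) = s2act l u • v + u • s2act l v.
Proof.
move: u; apply: (s2_ext (g := fun u => s2act l (u • v))
   (h := fun u => s2act l u • v + u • s2act l v)) => [a u u'|a u u'|x y].
- by rewrite s2prod_linearl s2act_linear.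
- by rewrite s2act_linear !s2prod_linearl scalerDr addrACA.
move: v; apply: (s2_ext (g := fun v => s2act l (_ • v))
   (h := fun v => s2act l _ • v + _ • s2act l v)) => [a u u'|a u u'|z t].
- by rewrite s2prod_linearr s2act_linear.
- by rewrite s2act_linear !s2prod_linearr scalerDr addrACA.
(* By invariance the two terms with a bracket inside [kappa] add up to zero; inserting them gives
   the shape of the right-hand side. *)
have act_term a b p q : s2act l (kappa a b *: s2mul p q) =
    kappa (lie l a) b *: s2mul p q + kappa a b *: s2mul (lie l p) q
    + (kappa a (lie l b) *: s2mul p q + kappa a b *: s2mul p (lie l q)).
  by rewrite s2actZ s2actE scalerDr addrACA kappa_inv -scalerDl addNr scale0r add0r.
have add4 (a b c d a' b' c' d' : sym2 L) :
    a + b + c + d + (a' + b' + c' + d') = a + a' + (b + b') + (c + c') + (d + d').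
  by rewrite addrACA [a + b + c + _]addrACA [a + b + _]addrACA.
rewrite s2prodE !s2actE s2prodDl s2prodDr !s2prodE -!scalerDr s2actZ; congr (_ *: _).
rewrite [X in _ = X + _]add4 [X in _ = _ + X]add4 [RHS]add4 !s2actD.
rewrite (act_term x z y t) (act_term x t y z) (act_term y z x t) (act_term y t x z).
rewrite [X in _ = _ + (_ + X) + _ + _]addrC [X in _ = _ + (X + _) + _]addrC.
by rewrite [X in _ = _ + (X + _)]addrC [X in _ = _ + (_ + X)]addrC.
Qed.

End InvariantForm.

(** * Reproducing families for [kappa] and nondegeneracy on the symmetric square *)

Section Frame.
Variables (F : numFieldType) (L : lieAlgType F) (kappa : {symmetric L}).
Implicit Types (x y : L) (u v w : sym2 L).
Local Notation B := (s2form kappa).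

Variables (zs : seq L) (g : L -> L).
Hypothesis frame : forall x, x = \sum_(z <- zs) kappa x z *: g z.

Lemma s2_frame u :
  u = \sum_(z <- zs) \sum_(t <- zs) B u (s2mul z t) *: s2mul (g z) (g t).
Proof.
move: u; apply: (s2_ext (g := id) (h := fun u => \sum_(z <- zs) \sum_(t <- zs)
  B u (s2mul z t) *: s2mul (g z) (g t))) => [//|a u v|x y].
  rewrite scaler_sumr -big_split; apply: eq_bigr => z _ /=.
  rewrite scaler_sumr -big_split; apply: eq_bigr => t _ /=.
  by rewrite s2formDl s2formZl scalerDl scalerA.
have mulE p q : s2mul p q = \sum_(z <- zs) \sum_(t <- zs)
    (kappa p z * kappa q t) *: s2mul (g z) (g t).
  rewrite {1}(frame p) (linear_comb (s2mul_linearl q)); apply: eq_bigr => z _.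
  rewrite {1}(frame q) (linear_comb (s2mul_linearr _)) scaler_sumr.
  by apply: eq_bigr => t _; rewrite scalerA.
have halve (w : sym2 L) : w = 2^-1 *: (w + w).
  by rewrite -mulr2n -scaler_nat scalerA mulVf ?scale1r // pnatr_eq0.
(* [B] symmetrises the coefficients [kappa x z * kappa y t], so the expansion is averaged over the
   two orders of the factors. *)
rewrite [LHS]halve {2}s2mulC [in LHS]mulE [X in _ + X]mulE -big_split scaler_sumr.
apply: eq_bigr => z _; rewrite -big_split scaler_sumr; apply: eq_bigr => t _ /=.
by rewrite s2formE -scalerDl scalerA [kappa y z * _]mulrC.
Qed.

Lemma s2form_nondeg u : (forall v, B u v = 0) -> u = 0.
Proof.
move=> u0; rewrite [u]s2_frame big1 // => z _.
by rewrite big1 // => t _; rewrite u0 scale0r.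
Qed.

End Frame.

(** * Orthogonal complements and dimensions *)

Section Orthogonal.
Variables (F : numFieldType) (W : vectType F) (form : {symmetric W}) (V : {vspace W}).
Local Notation A := (orthov form V).

Definition form_coords x : 'rV[F]_(\dim V) := \row_i form x (vbasis V)`_i.

Lemma form_coords_linear : linear form_coords.
Proof. by move=> a x y; apply/rowP => i; rewrite !mxE linearPl. Qed.

HB.instance Definition _ :=
  GRing.isLinear.Build F W 'rV[F]_(\dim V) _ form_coords form_coords_linear.

(** The kernel of [form_coords], which imposes [\dim V] linear conditions, lies in the
    complement. *)
Lemma dim_orthov : (\dim {:W} <= \dim A + \dim V)%N.
Proof.
rewrite -(limg_ker_dim (linfun form_coords) fullv) capfv leq_add //; last first.
  by rewrite (leq_trans (dimvS (subvf _))) // dimvf dim_matrix mul1r.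
apply/dimvS/subvP => x; rewrite memv_ker lfunE => /eqP/rowP x0.
apply/mem_orthovP => v /coord_vbasis ->; rewrite linear_sumr big1 // => i _.
by have := x0 i; rewrite !mxE linearZr /= => ->; rewrite mulr0.
Qed.

Lemma orthov_complement : (V :&: A = 0)%VS -> (A + V = fullv)%VS.
Proof.
move=> VA0; apply/eqP; rewrite eqEdim subvf /=.
by rewrite dimv_disjoint_sum ?dim_orthov // capvC.
Qed.

End Orthogonal.

(** * Descent of the Frobenius structure to the orthogonal complement *)

Section FrobeniusComplement.
Variables (F : numFieldType) (L : lieAlgType F) (kappa : {symmetric L}).
Hypothesis kappa_inv : forall l x y, kappa (lie l x) y = - kappa x (lie l y).
Hypothesis B_nondeg : forall u, (forall v, s2form kappa u v = 0) -> u = 0.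
Variable V : {vspace sym2 L}.
Hypothesis V_submod : is_submodule (@s2act _ L) V.
Local Notation A := (Aspace kappa V).
Local Notation B := (s2form kappa).
Local Notation pr := (Aproj kappa V).
Hypothesis VA0 : forall r, r \in V -> r \in A -> r = 0.
Implicit Types (l : L) (u v w : sym2 L) (a b : subvs_of A).

Lemma Aspace_submod : is_submodule (@s2act _ L) A.
Proof.
move=> l u /mem_AspaceP uA; apply/mem_AspaceP => w wV.
have /eqP := s2form_inv kappa_inv l u w.
by rewrite (uA _ (V_submod _ wV)) addr0 => /eqP.
Qed.

Lemma capAV : (A :&: V = 0)%VS.
Proof.
by apply/eqP; rewrite -subv0; apply/subvP => r /memv_capP[rA rV];
  rewrite (VA0 rV rA) mem0v.
Qed.

Lemma Aproj_mem u : pr u \in A. Proof. exact: memv_pi. Qed.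

Lemma Aproj_diff u : u - pr u \in V.
Proof.
have uAV : u \in (A + V)%VS by rewrite orthov_complement ?memvf // capvC capAV.
by rewrite -{1}(daddv_pi_add capAV uAV) addrC addKr memv_pi.
Qed.

(** As [A] and [V] meet trivially, [u = v + (u - v)] is the only such decomposition. This yields
    equivariance of [pr] without computing it. *)
Lemma Aproj_uniq u v : v \in A -> u - v \in V -> pr u = v.
Proof.
move=> vA uvV; apply/eqP; rewrite -subr_eq0; apply/eqP/VA0; last first.
  by rewrite memvB ?Aproj_mem.
have -> : pr u - v = (u - v) - (u - pr u) by rewrite opprB [RHS]addrC addrA subrK.
by rewrite memvB ?Aproj_diff.
Qed.

Lemma Aproj_act l u : pr (s2act l u) = s2act l (pr u).
Proof.
apply: Aproj_uniq; first exact/Aspace_submod/Aproj_mem.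
rewrite -(linear_morphN (s2act_linear l)) -s2actD.
exact/V_submod/Aproj_diff.
Qed.

(** The difference [u - pr u] lies in [V], hence is orthogonal to [A]. The projection in [Aprod] can
    thus be dropped inside the form, which reduces associativity to [s2prod_assoc]. *)
Lemma form_Aproj u a : B (pr u) (vsval a) = B u (vsval a).
Proof.
rewrite -{2}[u](subrK (pr u)) s2formDl [X in X + _]s2formC.
by have /mem_AspaceP -> := subvsP a; rewrite ?add0r ?Aproj_diff.
Qed.

Lemma Aform_nondeg a : (forall b, Aform a b = 0) -> a = 0.
Proof.
move=> a0; apply: val_inj; rewrite /=; apply: B_nondeg => v.
(* The test vector splits into a part in [V], orthogonal to [a], and a part in [A], covered by
   [a0]. *)
rewrite -[v](subrK (pr v)) s2formDr.
have /mem_AspaceP -> := subvsP a; rewrite ?Aproj_diff // add0r.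
by have := a0 (vsproj A (pr v)); rewrite /Aform vsprojK // Aproj_mem.
Qed.

Lemma Aspace_frobenius :
  is_frobenius_algebra_for (subact (@s2act _ L) (U := A)) (@Aprod _ L kappa V)
    (@Aform _ L kappa V).
Proof.
have subactE l a : vsval (subact (@s2act _ L) l a) = s2act l (vsval a).
  by rewrite /subact vsprojK //; apply/Aspace_submod/subvsP.
have AP a b (c : F) : vsval (c *: a + b) = c *: vsval a + vsval b by [].
split; first split.
- move=> b c a a'; apply: val_inj.
  by rewrite /= !vsval_Aprod s2prod_linearl linearP.
- move=> b c a a'; apply: val_inj.
  by rewrite /= !vsval_Aprod s2prod_linearr linearP.
- by move=> b c a a'; rewrite /Aform AP s2form_linearl.
- by move=> b c a a'; rewrite /Aform AP s2form_linearr.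
- by move=> a b; apply: s2formC.
- exact: Aform_nondeg.
- by move=> a b; rewrite /Aprod s2prodC.
- move=> a b b'; rewrite /Aform !vsval_Aprod form_Aproj s2prod_assoc.
  by rewrite [RHS]s2formC form_Aproj s2formC.
- split.
  + move=> a c l l'; apply: val_inj.
    by rewrite /= !subactE s2act_linearl.
  + by move=> l c a a'; apply: val_inj; rewrite /= !subactE AP s2act_linear.
  + move=> l m a; apply: val_inj; rewrite /= !subactE.
    exact: lact_lie (s2act_module L) l m _.
- move=> l a b; apply: val_inj.
  rewrite /= subactE !vsval_Aprod !subactE -Aproj_act.
  by rewrite (s2prod_act kappa_inv) linearD.
- by move=> l a b; rewrite /Aform !subactE s2form_inv.
Qed.

End FrobeniusComplement.

(** * Positivity from a compact real structure *)

Section RealStructure.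
Variables (C : numClosedFieldType) (L : lieAlgType C) (kappa : {symmetric L}).
Implicit Types (x y l : L) (u v w : sym2 L).
Local Notation B := (s2form kappa).

(** [s2_ext] compares linear maps only; this induction serves the antilinear [s2conj]. *)
Lemma s2_ind (P : sym2 L -> Prop) :
  P 0 -> (forall a u v, P u -> P v -> P (a *: u + v)) ->
  (forall x y, P (s2mul x y)) -> forall u, P u.
Proof.
move=> P0 PD Pmul u; rewrite [u]s2_decomp /s2lift.
have Psum I (r : seq I) f : (forall i, P (f i)) -> P (\sum_(i <- r) f i).
  move=> Pf; elim: r => [|i r IHr]; rewrite ?big_nil ?big_cons //.
  by rewrite -[f i]scale1r; apply: PD.
apply: (Psum) => i; apply: Psum => j.
by rewrite -[_ *: _]addr0; apply: PD.
Qed.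

(** A subspace inside [P] that misses a vector of [P] can be enlarged by it, which finite dimension
    allows only finitely often. *)
Lemma mem_linear_closed (W : vectType C) (P : W -> Prop) :
  P 0 -> (forall a p q, P p -> P q -> P (a *: p + q)) ->
  exists U : {vspace W}, forall x : W, x \in U <-> P x.
Proof.
move=> P0 PD.
have grow (U : {vspace W}) : (forall x : W, x \in U -> P x) ->
    exists U' : {vspace W}, forall x : W, x \in U' <-> P x.
  have [d] := ubnP (\dim {:W} - \dim U); elim: d U => // d IHd U dU UP.
  have [[x [Px xU]]|noU] := EM (exists x : W, P x /\ x \notin U); last first.
    exists U => x; split=> [/UP//|Px]; apply/negPn/negP => xU.
    by apply: noU; exists x.
  apply: (IHd (U + <[x]>)%VS); last first.
    move=> _ /memv_addP[y /UP Py [_ /vlineP[a ->] ->]].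
    by rewrite addrC; apply: PD.
  have ltU : (\dim U < \dim (U + <[x]>))%N.
    rewrite ltn_neqAle dimvS ?addvSl // andbT.
    apply: contra xU => /eqP eqU; have /eqP -> : U == (U + <[x]>)%VS.
      by rewrite eqEdim addvSl -eqU leqnn.
    by rewrite memvE addvSr.
  rewrite -ltnS; apply: leq_trans dU; rewrite ltnS ltn_sub2l //.
  by apply: leq_trans ltU _; rewrite dimvS ?subvf.
by apply: (grow 0%VS) => x; rewrite memv0 => /eqP->.
Qed.

(** The minimality of [V] is applied to the subspace cut out by [P]. *)
Lemma generated_submodule_ind (W : vectType C) (act : L -> W -> W) (v0 : W)
    (V : {vspace W}) (P : W -> Prop) :
  is_generated_submodule act v0 V -> P v0 ->
  P 0 -> (forall a p q, P p -> P q -> P (a *: p + q)) ->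
  (forall l p, P p -> P (act l p)) -> forall p, p \in V -> P p.
Proof.
case=> _ _ Vmin Pv0 P0 PD Pact v vV.
have [U UP] := mem_linear_closed P0 PD.
apply/UP; have /subvP -> // : (V <= U)%VS.
by apply: Vmin => [l u /UP Pu|]; apply/UP => //; apply: Pact.
Qed.

Variables (sigma : L -> L) (zs : seq L).
Hypothesis sigmaP : forall a x y, sigma (a *: x + y) = a^* *: sigma x + sigma y.
Hypothesis sigma_lie : forall x y, sigma (lie x y) = lie (sigma x) (sigma y).
Hypothesis kappa_sigma : forall x y, kappa (sigma x) (sigma y) = (kappa x y)^*.
(** Paired with [- sigma y], this makes [- kappa x (sigma y)] the sum of the
    [kappa x z * (kappa y z)^*], hence a positive definite hermitian form. *)
Hypothesis frame : forall x, x = \sum_(z <- zs) kappa x z *: - sigma z.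

(** [s2lift] extends linearly, so the antilinear extension of [sigma] is written in coordinates,
    with conjugated coefficients. *)
Definition s2conj u : sym2 L :=
  \sum_i \sum_j (Defs.s2val u i j)^* *:
    s2mul (sigma (vbasis {:L})`_i) (sigma (vbasis {:L})`_j).

Lemma sigma0 : sigma 0 = 0.
Proof. by have := sigmaP (-1) 0 0; rewrite rmorphN1 !scaleN1r oppr0 addr0 addNr. Qed.

Lemma s2conjP a u v : s2conj (a *: u + v) = a^* *: s2conj u + s2conj v.
Proof.
rewrite /s2conj scaler_sumr -big_split; apply: eq_bigr => i _.
rewrite scaler_sumr -big_split; apply: eq_bigr => j _.
by rewrite [Defs.s2val _]Defs.s2val_linear !mxE rmorphD rmorphM scalerDl scalerA.
Qed.

Lemma s2conj0 : s2conj 0 = 0.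
Proof. by have := s2conjP (-1) 0 0; rewrite rmorphN1 !scaleN1r oppr0 addr0 addNr. Qed.

Lemma s2conjD u v : s2conj (u + v) = s2conj u + s2conj v.
Proof. by have := s2conjP 1 u v; rewrite rmorph1 !scale1r. Qed.

Lemma sigma_comb I (r : seq I) (a : I -> C) (f : I -> L) :
  sigma (\sum_(i <- r) a i *: f i) = \sum_(i <- r) (a i)^* *: sigma (f i).
Proof.
by elim: r => [|i r IHr]; rewrite ?big_nil ?sigma0 // !big_cons sigmaP IHr.
Qed.

Lemma s2conj_mul x y : s2conj (s2mul x y) = s2mul (sigma x) (sigma y).
Proof.
pose b := vbasis {:L}.
have sE p q : s2mul (sigma p) (sigma q) = \sum_i \sum_j
    (tensor p q i j)^* *: s2mul (sigma b`_i) (sigma b`_j) :> sym2 L.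
  rewrite {1}(coord_vbasis (memvf p)) sigma_comb (linear_comb (s2mul_linearl _)).
  apply: eq_bigr => i _.
  rewrite {1}(coord_vbasis (memvf q)) sigma_comb (linear_comb (s2mul_linearr _)).
  rewrite scaler_sumr; apply: eq_bigr => j _.
  by rewrite scalerA !mxE big_ord1 !mxE rmorphM.
(* The coordinates of [s2mul x y] are the average of those of the two tensors, and [sE] applies to
   each. *)
transitivity (2^-1 *: (s2mul (sigma x) (sigma y) + s2mul (sigma y) (sigma x)) : sym2 L).
  rewrite !sE -big_split scaler_sumr; apply: eq_bigr => i _ /=.
  rewrite -big_split scaler_sumr; apply: eq_bigr => j _ /=.
  rewrite Defs.s2val_s2mul 2!mxE rmorphM rmorphD.
  by rewrite fmorphV rmorph_nat -scalerDl scalerA.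
rewrite (s2mulC (sigma y)) -mulr2n -scaler_nat scalerA mulVf ?scale1r //.
by rewrite pnatr_eq0.
Qed.

Lemma s2conj_act l u : s2conj (s2act l u) = s2act (sigma l) (s2conj u).
Proof.
move: u; apply: s2_ind => [|a u v IHu IHv|x y].
- by rewrite s2conj0 !(linear_morph0 (s2act_linear _)) s2conj0.
- by rewrite s2act_linear !s2conjP s2act_linear IHu IHv.
by rewrite s2conj_mul !s2actE s2conjD !s2conj_mul !sigma_lie.
Qed.

Lemma s2form_conj u v : B (s2conj u) (s2conj v) = (B u v)^*.
Proof.
have B0 w : B 0 w = 0.
  exact: (linear_morph0 (f := B^~ w : _ -> C^o) (s2form_linearl _ w)).
move: u; apply: s2_ind => [|a u u' IHu IHu'|x y].
- by rewrite s2conj0 !B0 rmorph0.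
- by rewrite s2conjP !s2form_linearl IHu IHu' rmorphD rmorphM.
move: v; apply: s2_ind => [|a u u' IHu IHu'|z t].
- by rewrite s2conj0 !(s2formC _ _ 0) !B0 rmorph0.
- by rewrite s2conjP !s2form_linearr IHu IHu' rmorphD rmorphM.
by rewrite !s2conj_mul !s2formE !kappa_sigma rmorphM rmorphD !rmorphM fmorphV rmorph_nat.
Qed.

(** In the frame expansion of [u] the signs of [- sigma z] and [- sigma t] cancel, so [u] is a
    combination of conjugates [s2conj (s2mul z t)]. Then [B u (s2conj u)] is the sum of the squared
    moduli of the coefficients. *)
Lemma s2form_pos u : B u (s2conj u) = 0 -> u = 0.
Proof.
have uE : u = \sum_(z <- zs) \sum_(t <- zs) B u (s2mul z t) *: s2conj (s2mul z t).
  rewrite {1}[u](s2_frame frame); apply: eq_bigr => z _; apply: eq_bigr => t _.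
  have NN : s2mul (- sigma z) (- sigma t) = s2mul (sigma z) (sigma t) :> sym2 L.
    by rewrite (s2mulNl (sigma z)) s2mulC (s2mulNl (sigma t)) opprK s2mulC.
  by rewrite s2conj_mul NN.
have -> : B u (s2conj u) = \sum_(z <- zs) \sum_(t <- zs) `|B u (s2mul z t)| ^+ 2.
  have lin := s2form_linearl kappa (s2conj u).
  have Bsum I (r : seq I) (f : I -> sym2 L) : B (\sum_(i <- r) f i) (s2conj u)
      = \sum_(i <- r) B (f i) (s2conj u).
    elim: r => [|i r IHr]; rewrite ?big_nil ?big_cons ?s2formDl ?IHr //.
    exact: (linear_morph0 (f := B^~ _ : _ -> C^o) lin).
  rewrite {1}uE Bsum; apply: eq_bigr => z _; rewrite Bsum; apply: eq_bigr => t _.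
  by rewrite s2formZl s2form_conj s2formC normCK.
have sq_ge0 z t : 0 <= `|B u (s2mul z t)| ^+ 2 by rewrite exprn_ge0.
move=> /eqP; rewrite psumr_eq0 => [/allP u0|z _]; last by apply: sumr_ge0.
rewrite uE big_seq big1 // => z /u0.
rewrite psumr_eq0 // => /allP z0; rewrite big_seq big1 // => t /z0.
by rewrite sqrf_eq0 normr_eq0 => /eqP ->; rewrite scale0r.
Qed.

Lemma generated_submodule_cap (V : {vspace sym2 L}) (v0 : sym2 L) :
  is_generated_submodule (@s2act _ L) v0 V -> s2conj v0 \in V ->
  forall r, r \in V -> r \in Aspace kappa V -> r = 0.
Proof.
move=> Vgen Vv0 r rV /mem_AspaceP rA; apply: s2form_pos; apply: rA.
have [Vsub _ _] := Vgen.
(* It remains to see that [s2conj] maps [V] to itself: this holds at the generator, and [s2conj_act]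
   carries it along the action. *)
move: r rV; apply: (generated_submodule_ind Vgen) => //.
- by rewrite s2conj0 mem0v.
- by move=> a u v uV vV; rewrite s2conjP memvD ?memvZ.
by move=> l u uV; rewrite s2conj_act Vsub.
Qed.

End RealStructure.

(** * Traces and antilinear maps determined on a basis *)

Section Bases.
Variables (F : fieldType) (W : vectType F).

Lemma basis_closed (X : seq W) (P : W -> Prop) : basis_of fullv X ->
  P 0 -> (forall a x y, P x -> P y -> P (a *: x + y)) ->
  (forall x, x \in X -> P x) -> forall x, P x.
Proof.
move=> Xb P0 PD PX x.
have /coord_span -> : x \in <<in_tuple X>>%VS by rewrite (span_basis Xb) memvf.
elim/big_ind: _ => // [y z Py Pz|i _].
  by rewrite -[y]scale1r; apply: PD.
by rewrite -[_ *: _]addr0; apply: PD => //; apply/PX/mem_nth.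
Qed.

Lemma mxtrace_diag (ws : seq (W * F)) (f : 'End(W)) :
  basis_of fullv (unzip1 ws) -> (forall p, p \in ws -> f p.1 = p.2 *: p.1) ->
  \tr (mxof (vbasis {:W}) (vbasis {:W}) f) = \sum_(p <- ws) p.2.
Proof.
move=> Xb fX; have sX : size (unzip1 ws) == \dim {:W}.
  by rewrite (size_basis (X := in_tuple _) Xb).
pose X := Tuple sX; have XB : basis_of fullv X by [].
have vB := vbasisP {:W}; have Xf := basis_free XB.
(* Cyclicity of the trace allows passing to the eigenbasis [X], where the matrix is diagonal. *)
have -> : \tr (mxof (vbasis {:W}) (vbasis {:W}) f) = \tr (mxof X X f).
  rewrite -[f in LHS]comp_lfun1r (mxof_comp _ _ XB) mxtrace_mulC.
  by rewrite -(mxof_comp _ _ vB) comp_lfun1l.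
have sw : size ws = \dim {:W} by rewrite -(eqP sX) size_map.
rewrite /mxtrace (big_nth (0, 0)) sw big_mkord; apply: eq_bigr => i _.
have iw : (i < size ws)%N by rewrite sw.
rewrite !mxE /= vecof_delta.
have XiE : X`_i = (nth (0, 0) ws i).1 by rewrite (nth_map (0, 0)).
rewrite XiE fX ?mem_nth // -XiE linearZ /= coord_free // eqxx mulr1 //.
Qed.

End Bases.

Lemma antilinear_extension (C : numClosedFieldType) (W : vectType C)
    (ws : seq (W * W)) : basis_of fullv (unzip1 ws) ->
  exists2 f : W -> W, forall a x y, f (a *: x + y) = a^* *: f x + f y
    & forall p, p \in ws -> f p.1 = p.2.
Proof.
move=> Xb; pose X := in_tuple (unzip1 ws).
exists (fun x => \sum_k (coord X k x)^* *: (nth (0, 0) ws k).2) => [a x y|p pw].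
  rewrite scaler_sumr -big_split; apply: eq_bigr => k _ /=.
  by rewrite linearP rmorphD rmorphM scalerDl scalerA.
have ip : (index p ws < size (unzip1 ws))%N by rewrite size_map index_mem.
have pE : p.1 = X`_(Ordinal ip) by rewrite /= (nth_map (0, 0)) ?index_mem // nth_index.
rewrite (bigD1 (Ordinal ip)) //= pE coord_free ?(basis_free Xb) // eqxx.
rewrite rmorph1 scale1r nth_index // big1 ?addr0 // => k kp.
by rewrite coord_free ?(basis_free Xb) // eq_sym (negPf kp) rmorph0 scale0r.
Qed.

(** * Root systems and the Chevalley basis *)

Section RootSystem.
Variables (C : numClosedFieldType) (L : lieAlgType C) (H : {vspace L}) (n : nat).
Implicit Types (alpha beta : hdual H) (x y : L) (s t : subvs_of H).

Lemma hpairD alpha beta t : hpair (alpha + beta) t = hpair alpha t + hpair beta t.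
Proof. exact: (@add_lfunE C (subvs_of H) C^o alpha beta t). Qed.

Lemma hpairN alpha t : hpair (- alpha) t = - hpair alpha t.
Proof. exact: (@opp_lfunE C (subvs_of H) C^o alpha t). Qed.

Lemma hpair0 t : hpair (0 : hdual H) t = 0.
Proof. exact: (@zero_lfunE C (subvs_of H) C^o t). Qed.

Lemma hpair_sum I (r : seq I) (a : I -> hdual H) t :
  hpair (\sum_(i <- r) a i) t = \sum_(i <- r) hpair (a i) t.
Proof.
by elim: r => [|i r IHr]; rewrite ?big_nil ?hpair0 // !big_cons hpairD IHr.
Qed.

Lemma hpairMn alpha k t : hpair (alpha *+ k) t = hpair alpha t *+ k.
Proof. by elim: k => [|k IHk]; rewrite ?mulr0n ?hpair0 // !mulrS hpairD IHk. Qed.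

Lemma hpair_linear alpha : scalar (hpair alpha).
Proof. by move=> a s t; rewrite /hpair linearP. Qed.

Lemma mem_lie_prod (U U' : {vspace L}) x y :
  x \in U -> y \in U' -> lie x y \in lie_prod U U'.
Proof.
move=> /coord_vbasis -> /coord_vbasis ->.
rewrite (linear_comb (lie_linearl _)); apply: memv_suml => i _; apply: memvZ.
rewrite (linear_comb (lie_linearr _)); apply: memv_suml => j _; apply: memvZ.
by apply/memv_span/allpairs_f; apply: mem_nth; rewrite size_tuple.
Qed.

Lemma root_spaceD alpha beta x y : in_root_space alpha x -> in_root_space beta y ->
  in_root_space (alpha + beta) (lie x y).
Proof.
move=> xa yb t; rewrite hpairD scalerDl.
have /eqP := lie_lie (vsval t) x y.
by rewrite eq_sym subr_eq xa yb lieZl lieZr => /eqP.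
Qed.

Variables (Delta : 'I_n -> hdual H) (h : hdual H -> subvs_of H) (e : hdual H -> L).
Variables (Phi : seq (hdual H)) (N : hdual H -> hdual H -> C) (c : C) (i0 : 'I_n).
Local Notation kappa := (@rescaled_killing C L c).
Local Notation hL alpha := (vsval (h alpha)).

Hypothesis lieH : (lie_prod H H <= H)%VS.
Hypothesis Delta_base : is_base Delta.
Hypothesis coroot_h : forall alpha, is_root alpha -> is_coroot alpha (h alpha).
Hypothesis Cartan_real : forall i j, hpair (Delta j) (h (Delta i)) \is Num.real.
Hypothesis Phi_uniq : uniq Phi.
Hypothesis PhiP : forall alpha, alpha \in Phi <-> is_root alpha.
Hypothesis chevalley_basis :
  basis_of fullv ([seq hL (Delta i) | i <- enum 'I_n] ++ [seq e alpha | alpha <- Phi]).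
Hypothesis e_root : forall alpha, is_root alpha -> in_root_space alpha (e alpha).
Hypothesis lie_eNe : forall alpha, is_root alpha -> lie (e alpha) (e (- alpha)) = hL alpha.
Hypothesis lie_ee : forall alpha beta,
  is_root alpha -> is_root beta -> is_root (alpha + beta) ->
  lie (e alpha) (e beta) = N alpha beta *: e (alpha + beta)
  /\ N alpha beta = - N (- alpha) (- beta).
Hypothesis kappa_hh : forall alpha, is_root alpha -> kappa (hL alpha) (hL alpha) = 2.

Let two_neq0 : 2 != 0 :> C. Proof. by rewrite pnatr_eq0. Qed.

Lemma Delta_root i : is_root (Delta i). Proof. by have [] := Delta_base. Qed.

Lemma coroot2 alpha : is_root alpha -> hpair alpha (h alpha) = 2.
Proof. by move/coroot_h => []. Qed.

(** The coroot is a bracket with a vector of weight [- alpha]; were that vector zero, the coroot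
    would vanish, against [alpha (h alpha) = 2]. *)
Lemma rootN alpha : is_root alpha -> is_root (- alpha).
Proof.
move=> ra; have [[x [y [xa ya xy]]] a2] := coroot_h ra; have [a0 _] := ra.
split; first by rewrite oppr_eq0.
exists y => //; apply/eqP => y0.
have h0 : h alpha = 0 by apply: val_inj; rewrite /= -xy y0 lie0r.
by move/eqP: a2; rewrite h0 /hpair linear0 eq_sym (negPf two_neq0).
Qed.

Lemma e_neq0 alpha : is_root alpha -> e alpha != 0.
Proof.
move=> ra; apply/eqP => e0; have := lie_eNe ra; rewrite e0 lie0l => /esym h0.
have := kappa_hh ra; rewrite h0 /rescaled_killing.
have /linear_morph0 -> : linear (fun x => killing x (0 : L) : C^o).
  exact: killing_linearl.
by rewrite mulr0 => /esym/eqP; rewrite (negPf two_neq0).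
Qed.

Lemma simple_roots_separate t : (forall i, hpair (Delta i) t = 0) -> t = 0.
Proof.
move=> D0; have [_ Dbasis _] := Delta_base.
have all0 alpha : hpair alpha t = 0.
  move: alpha; apply: (basis_closed Dbasis) => [|a p q p0 q0|_ /mapP[i _ ->] //].
    exact: hpair0.
  by rewrite hpairD q0 addr0 /hpair scale_lfunE -/(hpair _ _) p0 scaler0.
rewrite (coord_vbasis (memvf t)) big1 // => i _.
(* The coordinate forms of [H] belong to its dual, which [Delta] spans. *)
have := all0 (linfun (coord (vbasis fullv) i : _ -> C^o)).
by rewrite /hpair lfunE => ->; rewrite scale0r.
Qed.

(* A bracket of elements of [H] lies in [H] and, by the Jacobi identity, acts by zero
   on every root vector. *)
Lemma lieHH s t : lie (vsval s) (vsval t) = 0.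
Proof.
have stH : lie (vsval s) (vsval t) \in H.
  by have /subvP -> // := lieH; apply: mem_lie_prod; apply: subvsP.
suff st0 : vsproj H (lie (vsval s) (vsval t)) = 0.
  by rewrite -(vsprojK stH) st0 linear0.
apply: simple_roots_separate => i; apply/eqP.
have ri := Delta_root i; have := e_root ri (vsproj H (lie (vsval s) (vsval t))).
rewrite vsprojK // lie_lie !(e_root ri) !lieZr !(e_root ri) !scalerA mulrC subrr.
by move=> /esym/eqP; rewrite scaler_eq0 (negPf (e_neq0 ri)) orbF.
Qed.

(** * The form [kappa] on root vectors and coroots *)

Lemma kappa_inv l x y : kappa (lie l x) y = - kappa x (lie l y).
Proof. exact: rescaled_killing_inv. Qed.

Lemma killC x y : kappa x y = kappa y x.
Proof. exact: rescaled_killingC. Qed.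

Lemma killDl x y z : kappa (x + y) z = kappa x z + kappa y z.
Proof. exact: (linear_morphD (f := kappa^~ z : _ -> C^o) (rescaled_killing_linearl c z)). Qed.
Lemma killZl a x z : kappa (a *: x) z = a * kappa x z.
Proof. exact: (linear_morphZ (f := kappa^~ z : _ -> C^o) (rescaled_killing_linearl c z)). Qed.
Lemma kill0l z : kappa 0 z = 0.
Proof. exact: (linear_morph0 (f := kappa^~ z : _ -> C^o) (rescaled_killing_linearl c z)). Qed.
Lemma killNl x z : kappa (- x) z = - kappa x z.
Proof. exact: (linear_morphN (f := kappa^~ z : _ -> C^o) (rescaled_killing_linearl c z)). Qed.
Lemma killDr x y z : kappa z (x + y) = kappa z x + kappa z y.
Proof. by rewrite !(killC z) killDl. Qed.
Lemma killZr a x z : kappa z (a *: x) = a * kappa z x.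
Proof. by rewrite !(killC z) killZl. Qed.
Lemma killNr x z : kappa z (- x) = - kappa z x.
Proof. by rewrite !(killC z) killNl. Qed.
Lemma kill_suml I (r : seq I) (f : I -> L) z :
  kappa (\sum_(i <- r) f i) z = \sum_(i <- r) kappa (f i) z.
Proof. by elim: r => [|i r IHr]; rewrite ?big_nil ?kill0l // !big_cons killDl IHr. Qed.

(** Invariance gives [(alpha + beta) t * kappa x y = 0] for every [t] in [H]. *)
Lemma root_spaces_orthogonal alpha beta x y :
  in_root_space alpha x -> in_root_space beta y -> alpha + beta != 0 -> kappa x y = 0.
Proof.
move=> xa yb ab0; apply/eqP/negPn/negP => kxy; move/eqP: ab0; apply.
apply/lfunP => t; rewrite -/(hpair _ _) hpairD zero_lfunE; apply/eqP.
have /eqP := kappa_inv (vsval t) x y.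
rewrite xa yb killZl killZr -addr_eq0 -mulrDl mulf_eq0 (negPf kxy) orbF.
by [].
Qed.

Lemma root_space0 t : in_root_space (0 : hdual H) (vsval t).
Proof. by move=> s; rewrite lieHH hpair0 scale0r. Qed.

Lemma kappa_he t alpha : is_root alpha -> kappa (vsval t) (e alpha) = 0.
Proof.
move=> ra; apply: (root_spaces_orthogonal (root_space0 t) (e_root ra)).
by rewrite add0r; have [] := ra.
Qed.

(** For [alpha = - beta], invariance turns [kappa_hh] into [2 = beta (h beta) * kappa (e beta) (e (-
    beta))], whose first factor is 2. *)
Lemma kappa_ee alpha beta : is_root alpha -> is_root beta ->
  kappa (e alpha) (e beta) = (alpha == - beta)%:R.
Proof.
move=> ra rb; have [->|ab] := eqVneq; last first.
  by apply: (root_spaces_orthogonal (e_root ra) (e_root rb)); rewrite addr_eq0.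
rewrite killC; have := kappa_hh rb; rewrite -{1}(lie_eNe rb) kappa_inv lieC killNr opprK.
rewrite (e_root rb) coroot2 // killZr => k2.
by apply: (mulfI two_neq0); rewrite [RHS]mulr1 killC.
Qed.

(** This makes [h alpha] the [kappa]-dual of [alpha], so identities between coroots reduce to
    identities between roots. *)
Lemma kappa_ht alpha t : is_root alpha -> kappa (hL alpha) (vsval t) = hpair alpha t.
Proof.
move=> ra; rewrite -(lie_eNe ra) kappa_inv lieC killNr opprK (e_root ra) killZr kappa_ee //.
  by rewrite eqxx mulr1.
exact: rootN.
Qed.

Lemma kappa_H_nondeg s : (forall t, kappa (vsval s) (vsval t) = 0) -> s = 0.
Proof.
move=> s0; apply: simple_roots_separate => i.
by rewrite -(kappa_ht _ (Delta_root i)) killC.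
Qed.

Lemma kappa_H_inj s s' :
  (forall t, kappa (vsval s) (vsval t) = kappa (vsval s') (vsval t)) -> s = s'.
Proof.
move=> ss'; apply/eqP; rewrite -subr_eq0; apply/eqP/kappa_H_nondeg => t.
by rewrite linearB /= killDl killNl ss' subrr.
Qed.

Lemma corootN alpha : is_root alpha -> h (- alpha) = - h alpha.
Proof.
move=> ra; apply: kappa_H_inj => t.
by rewrite linearN killNl !kappa_ht // ?hpairN //; apply: rootN.
Qed.

(** Taking [kappa]-duals is additive, and the dual is the coroot because [kappa_hh] gives all roots
    the same length. *)
Lemma corootD alpha beta : is_root alpha -> is_root beta -> is_root (alpha + beta) ->
  h (alpha + beta) = h alpha + h beta.
Proof.
move=> ra rb rab; apply: kappa_H_inj => t.
by rewrite linearD killDl !kappa_ht // hpairD.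
Qed.

Lemma root_real_comb alpha : is_root alpha -> exists m : 'I_n -> C,
  (forall i, m i \is Num.real) /\ h alpha = \sum_i m i *: h (Delta i).
Proof.
move=> ra; have [_ _ /(_ _ ra)] := Delta_base.
suff comb (m : 'I_n -> C) : (forall i, m i \is Num.real) ->
    (forall t, hpair alpha t = \sum_i m i * hpair (Delta i) t) ->
    exists m : 'I_n -> C,
    (forall i, m i \is Num.real) /\ h alpha = \sum_i m i *: h (Delta i).
  case=> -[k kE]; [apply: (comb (fun i => (k i)%:R)) | apply: (comb (fun i => - (k i)%:R))].
  - by move=> i; rewrite realn.
  - move=> t; rewrite kE hpair_sum; apply: eq_bigr => i _.
    by rewrite hpairMn mulr_natl.
  - by move=> i; rewrite realN realn.
  move=> t; rewrite -[alpha]opprK hpairN kE hpair_sum -sumrN; apply: eq_bigr => i _.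
  by rewrite hpairMn mulNr mulr_natl.
move=> m_real mE; exists m; split=> //; apply: kappa_H_inj => t.
rewrite kappa_ht // mE linear_sum kill_suml; apply: eq_bigr => i _.
by rewrite linearZ /= killZl kappa_ht //; apply: Delta_root.
Qed.

Lemma hpairC alpha beta : is_root alpha -> is_root beta ->
  hpair alpha (h beta) = hpair beta (h alpha).
Proof. by move=> ra rb; rewrite -!kappa_ht // killC. Qed.

Lemma hpair_comb alpha I (r : seq I) (m : I -> C) (t : I -> subvs_of H) :
  hpair alpha (\sum_(i <- r) m i *: t i) = \sum_(i <- r) m i * hpair alpha (t i).
Proof. exact: (linear_comb (f := hpair alpha : _ -> C^o) (hpair_linear alpha)). Qed.

(** Both coroots are expanded over the simple ones, with [hpairC] exchanging the roles of the
    arguments; only Cartan integers remain. *)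
Lemma hpair_real alpha beta : is_root alpha -> is_root beta ->
  hpair alpha (h beta) \is Num.real.
Proof.
move=> ra rb; have [m [mR ->]] := root_real_comb rb.
rewrite hpair_comb; apply: rpred_sum => i _; apply: rpredM => //.
have rD := Delta_root; rewrite hpairC //; have [k [kR ->]] := root_real_comb ra.
by rewrite hpair_comb; apply: rpred_sum => j _; apply: rpredM.
Qed.

(* The trace of [ad s \o ad t] in the Chevalley basis. *)
Lemma kappa_HH s t :
  kappa (vsval s) (vsval t) = c * \sum_(beta <- Phi) hpair beta s * hpair beta t.
Proof.
rewrite /rescaled_killing /killing; congr (_ * _).
pose ws := [seq (hL (Delta i), 0) | i <- enum 'I_n]
  ++ [seq (e beta, hpair beta s * hpair beta t) | beta <- Phi].
have w1 : unzip1 ws = [seq hL (Delta i) | i <- enum 'I_n] ++ [seq e beta | beta <- Phi].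
  by rewrite /unzip1 map_cat -!map_comp.
rewrite (@mxtrace_diag _ _ ws) ?w1 //.
  by rewrite big_cat !big_map /= big1 // add0r.
move=> p; rewrite mem_cat => /orP[/mapP[i _ ->]|/mapP[beta /PhiP rb ->]] /=.
  by rewrite comp_lfunE !adE lieHH lie0r scale0r.
by rewrite comp_lfunE !adE (e_root rb) lieZr (e_root rb) scalerA mulrC.
Qed.

(** By [kappa_HH], the simple root of index [i0] gives [2 = c * S] with [S] a sum of squares of real
    numbers. *)
Lemma c_gt0 : 0 < c.
Proof.
have ri := Delta_root i0; have := kappa_hh ri; rewrite kappa_HH.
set S := \sum_(_ <- _) _ => cS.
have S_ge0 : 0 <= S.
  rewrite /S big_seq; apply: sumr_ge0 => beta /PhiP rb.
  by rewrite -expr2 -realEsqr hpair_real.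
have S_gt0 : 0 < S.
  rewrite lt_def S_ge0 andbT; apply/eqP => S0.
  by move/eqP: cS; rewrite S0 mulr0 eq_sym (negPf two_neq0).
by rewrite -(pmulr_lgt0 _ S_gt0) cS ltr0n.
Qed.

(** Since coroots add, [2 = (alpha + beta) (h alpha + h beta) = 4 + 2 * alpha (h beta)]. *)
Lemma root_sum_pair alpha beta : is_root alpha -> is_root beta -> is_root (alpha + beta) ->
  hpair alpha (h beta) = -1.
Proof.
move=> ra rb rab; have := coroot2 rab; rewrite corootD // hpairD.
have hpairDr gamma s t : hpair gamma (s + t) = hpair gamma s + hpair gamma t.
  exact: (linear_morphD (f := hpair gamma : _ -> C^o) (hpair_linear gamma)).
rewrite !hpairDr !coroot2 // (hpairC rb ra) => /eqP.
rewrite -subr_eq0.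
have -> : 2 + hpair alpha (h beta) + (hpair alpha (h beta) + 2) - 2
  = 2 * (hpair alpha (h beta) + 1) by ring.
by rewrite mulf_eq0 (negPf two_neq0) addr_eq0 => /eqP.
Qed.

Lemma lie_ee0 alpha beta : is_root alpha -> is_root beta -> alpha + beta != 0 ->
  ~ is_root (alpha + beta) -> lie (e alpha) (e beta) = 0.
Proof.
move=> ra rb ab0 nrab; apply/eqP/negPn/negP => l0; apply: nrab; split=> //.
by exists (lie (e alpha) (e beta)) => //; apply: root_spaceD; apply: e_root.
Qed.

(* If [alpha - beta] were a root too, [hpair alpha (h beta)] would be both [-1] and [1]. *)
Lemma lie_eNe0 alpha beta : is_root alpha -> is_root beta -> is_root (alpha + beta) ->
  lie (e alpha) (e (- beta)) = 0.
Proof.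
move=> ra rb rab; have p := root_sum_pair ra rb rab; have rNb := rootN rb.
have neqN1 (k : nat) : k%:R != -1 :> C by rewrite -addr_eq0 natr1 pnatr_eq0.
apply: lie_ee0 => // [|rd].
  rewrite subr_eq0; apply/eqP => ab; move/eqP: p; rewrite ab coroot2 //.
  by rewrite (negPf (neqN1 _)).
have := root_sum_pair ra rNb rd; rewrite corootN //.
have -> : hpair alpha (- h beta) = - hpair alpha (h beta).
  exact: (linear_morphN (f := hpair alpha : _ -> C^o) (hpair_linear alpha)).
by rewrite p opprK => /eqP; rewrite (negPf (neqN1 1%N)).
Qed.

(* Compares two evaluations of [kappa ([e_a, e_b], [e_(-a), e_(-b)])]. *)
Lemma structure_constant_sqr alpha beta :
  is_root alpha -> is_root beta -> is_root (alpha + beta) -> N alpha beta ^+ 2 = 1.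
Proof.
move=> ra rb rab; have [rNa rNb] := (rootN ra, rootN rb); have rNab := rootN rab.
have [lab NE] := lie_ee ra rb rab.
have [|lNab _] := lie_ee rNa rNb; first by rewrite -opprD.
have : kappa (lie (e alpha) (e beta)) (lie (e (- alpha)) (e (- beta)))
    = - (N alpha beta ^+ 2).
  rewrite lab lNab -opprD killZl killZr kappa_ee // opprK eqxx mulr1.
  by rewrite -[N (- alpha) _]opprK -NE mulrN.
(* As [[e_a, e_(-b)] = 0], the Jacobi identity leaves [[h_a, e_(-b)]], with scalar
   [- beta (h alpha) = 1]. *)
have eNNE : lie (e alpha) (lie (e (- alpha)) (e (- beta))) = e (- beta).
  apply/eqP; rewrite -subr_eq0 -[X in _ - X]scale1r; apply/eqP.
  have := lie_lie (e alpha) (e (- alpha)) (e (- beta)).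
  rewrite (lie_eNe0 ra rb rab) lie0r subr0 lie_eNe // (e_root rNb) => <-.
  by rewrite hpairN hpairC // root_sum_pair // opprK subrr.
rewrite kappa_inv eNNE kappa_ee // opprK eqxx => /eqP.
by rewrite eqr_opp => /eqP.
Qed.

Lemma structure_constant_conj alpha beta :
  is_root alpha -> is_root beta -> is_root (alpha + beta) ->
  (N alpha beta)^* = N alpha beta.
Proof.
move=> ra rb rab.
have /eqP := structure_constant_sqr ra rb rab.
by rewrite sqrf_eq1 => /orP[] /eqP ->; rewrite ?rmorphN1 ?rmorph1.
Qed.

Lemma basis_ind (P : L -> Prop) :
  P 0 -> (forall a x y, P x -> P y -> P (a *: x + y)) ->
  (forall i, P (hL (Delta i))) -> (forall alpha, is_root alpha -> P (e alpha)) ->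
  forall x, P x.
Proof.
move=> P0 PD Ph Pe; apply: (basis_closed chevalley_basis) => // x.
by rewrite mem_cat => /orP[/mapP[i _ ->]|/mapP[alpha /PhiP ra ->]]; auto.
Qed.

(* Vectors [z] with [- kappa (x, sigma y) = \sum_z kappa (x, z) (kappa (y, z))^*]. *)
Definition frame_vectors :=
  [seq e (- alpha) | alpha <- Phi] ++ [seq sqrtC c *: hL alpha | alpha <- Phi].

(** * The compact conjugation [sigma] and its frame *)

Section Conjugation.
Variable sigma : L -> L.
Hypothesis sigmaP : forall a x y, sigma (a *: x + y) = a^* *: sigma x + sigma y.
Hypothesis sigma_hDelta : forall i, sigma (hL (Delta i)) = - hL (Delta i).
Hypothesis sigma_e : forall alpha, is_root alpha -> sigma (e alpha) = - e (- alpha).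

Lemma conj_real (a : C) : a \is Num.real -> a^* = a.
Proof. by move/CrealP. Qed.

Lemma sigmaZ a x : sigma (a *: x) = a^* *: sigma x.
Proof. by rewrite -[a *: x]addr0 sigmaP (sigma0 sigmaP) addr0. Qed.

Lemma sigmaN x : sigma (- x) = - sigma x.
Proof. by rewrite -!scaleN1r sigmaZ rmorphN1. Qed.

Lemma sigma_h alpha : is_root alpha -> sigma (hL alpha) = - hL alpha.
Proof.
move=> ra; have [m [mR ->]] := root_real_comb ra.
rewrite linear_sum /= -sumrN.
have -> : \sum_i vsval (m i *: h (Delta i)) = \sum_i m i *: hL (Delta i).
  by apply: eq_bigr => i _; rewrite linearZ.
rewrite (sigma_comb sigmaP); apply: eq_bigr => i _.
by rewrite sigma_hDelta conj_real // scalerN linearZ.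
Qed.

(** It is enough to compare brackets of basis vectors. There, roots take real values on coroots, the
    structure constants are real, and [N alpha beta = - N (- alpha) (- beta)] absorbs the signs. *)
Lemma sigma_lie x y : sigma (lie x y) = lie (sigma x) (sigma y).
Proof.
have s0 := sigma0 sigmaP.
move: x y; apply: basis_ind => [y|a x x' IHx IHx' y|i|alpha ra].
- by rewrite lie0l s0 lie0l.
- by rewrite lieDl lieZl !sigmaP IHx IHx' lieDl lieZl.
- apply: basis_ind => [|a y y' IHy IHy'|j|alpha ra].
  + by rewrite lie0r s0 lie0r.
  + by rewrite lieDr lieZr !sigmaP IHy IHy' lieDr lieZr.
  + by rewrite !sigma_hDelta lieNl lieNr !lieHH !oppr0 s0.
  rewrite sigma_hDelta sigma_e // lieNl lieNr opprK (e_root ra).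
  rewrite (e_root (rootN ra)) sigmaZ sigma_e // conj_real ?hpair_real //; last first.
    exact: Delta_root.
  by rewrite hpairN scalerN scaleNr.
apply: basis_ind => [|a y y' IHy IHy'|j|beta rb].
- by rewrite lie0r s0 lie0r.
- by rewrite lieDr lieZr !sigmaP IHy IHy' lieDr lieZr.
- rewrite lieC sigmaN sigma_hDelta sigma_e // lieNr lieNl opprK [RHS]lieC.
  rewrite (e_root ra) (e_root (rootN ra)) sigmaZ sigma_e // conj_real; last first.
    by apply: hpair_real => //; apply: Delta_root.
  by rewrite hpairN scalerN scaleNr.
rewrite !sigma_e // lieNl lieNr opprK.
have [rNa rNb] := (rootN ra, rootN rb).
have [ab0|ab0] := eqVneq (alpha + beta) 0.
  have -> : beta = - alpha by apply/eqP; rewrite -addr_eq0 addrC ab0.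
  by rewrite lie_eNe // sigma_h // lie_eNe // corootN // linearN.
have [rab|nrab] := EM (is_root (alpha + beta)).
  have [-> NE] := lie_ee ra rb rab; have [|-> _] := lie_ee rNa rNb.
    by rewrite -opprD; apply: rootN.
  by rewrite sigmaZ sigma_e // structure_constant_conj // NE scalerN scaleNr opprK opprD.
rewrite !lie_ee0 ?s0 // -opprD ?oppr_eq0 // => /rootN.
by rewrite opprK.
Qed.

Lemma kappa_sigma x y : kappa (sigma x) (sigma y) = (kappa x y)^*.
Proof.
have s0 := sigma0 sigmaP; have rD := Delta_root.
move: x y; apply: basis_ind => [y|a x x' IHx IHx' y|i|alpha ra].
- by rewrite s0 !kill0l rmorph0.
- by rewrite sigmaP !killDl !killZl IHx IHx' rmorphD (rmorphM _ a).
- apply: basis_ind => [|a y y' IHy IHy'|j|alpha ra].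
  + by rewrite s0 !(killC _ 0) !kill0l rmorph0.
  + by rewrite sigmaP !killDr !killZr IHy IHy' rmorphD (rmorphM _ a).
  + by rewrite !sigma_hDelta killNl killNr opprK kappa_ht // conj_real // hpair_real.
  rewrite sigma_hDelta sigma_e // killNl killNr opprK !kappa_he // ?rmorph0 //.
  exact: rootN.
apply: basis_ind => [|a y y' IHy IHy'|j|beta rb].
- by rewrite s0 !(killC _ 0) !kill0l rmorph0.
- by rewrite sigmaP !killDr !killZr IHy IHy' rmorphD (rmorphM _ a).
- rewrite sigma_hDelta sigma_e // killNl killNr opprK killC (killC (e alpha)).
  rewrite !kappa_he ?rmorph0 //.
  exact: rootN.
rewrite !sigma_e // killNl killNr opprK !kappa_ee //; try exact: rootN.
by rewrite rmorph_nat opprK eqr_oppLR.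
Qed.

(** On root vectors only the first family contributes, and the claim is the duality [kappa_ee]. On
    [H] only the second does; running over all roots instead of an orthonormal basis, it matches the
    trace formula [kappa_HH]. *)
Lemma frame_vectorsP x : x = \sum_(z <- frame_vectors) kappa x z *: - sigma z.
Proof.
have rD := Delta_root; have c_ge0 := ltW c_gt0.
(* Positivity of [c] makes [sqrtC c] real, so that its two occurrences multiply to [c]. *)
have sc alpha : is_root alpha -> - sigma (sqrtC c *: hL alpha) = sqrtC c *: hL alpha.
  move=> ra; rewrite sigmaZ sigma_h // scalerN opprK conj_real //.
  by rewrite ger0_real // sqrtC_ge0.
have -> : \sum_(z <- frame_vectors) kappa x z *: - sigma z =
    \sum_(alpha <- Phi) kappa x (e (- alpha)) *: e alpha
    + \sum_(alpha <- Phi) (c * kappa x (hL alpha)) *: hL alpha.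
  rewrite big_cat !big_map /=; congr (_ + _); rewrite big_seq [RHS]big_seq.
    apply: eq_bigr => alpha /PhiP ra; rewrite sigma_e ?opprK //; exact: rootN.
  apply: eq_bigr => alpha /PhiP ra; rewrite sc // killZr scalerA mulrAC.
  by rewrite -expr2 sqrtCK.
move: x; apply: basis_ind => [|a x y IHx IHy|i|beta rb].
- by rewrite !big1 ?addr0 // => alpha _; rewrite kill0l ?mulr0 scale0r.
- rewrite {1}IHx {1}IHy scalerDr addrACA.
  congr (_ + _); rewrite scaler_sumr -big_split; apply: eq_bigr => alpha _ /=;
    rewrite killDl killZl.
    by rewrite scalerDl scalerA.
  by rewrite mulrDr scalerDl scalerA mulrCA.
- rewrite big_seq big1 ?add0r => [|alpha /PhiP ra]; last first.
    by rewrite kappa_he ?scale0r //; apply: rootN.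
  (* Elements of [H] are equal once their pairings with [H] agree, which turns the claim into
     [kappa_HH]. *)
  transitivity (vsval (\sum_(alpha <- Phi) (c * kappa (hL (Delta i)) (hL alpha)) *: h alpha)).
    congr vsval; apply: kappa_H_inj => t.
    rewrite linear_sum kill_suml kappa_HH mulr_sumr big_seq [RHS]big_seq.
    apply: eq_bigr => alpha /PhiP ra.
    by rewrite linearZ /= killZl (kappa_ht t ra) (killC (hL (Delta i))) (kappa_ht _ ra) !mulrA.
  by rewrite linear_sum; apply: eq_bigr => alpha _; rewrite linearZ.
rewrite [X in _ + X]big_seq [X in _ + X]big1 ?addr0 => [|alpha /PhiP ra]; last first.
  by rewrite killC kappa_he // mulr0 scale0r.
have Pb : beta \in Phi by apply/PhiP.
rewrite (bigD1_seq beta) //= kappa_ee ?opprK ?eqxx ?scale1r //; last exact: rootN.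
rewrite big_seq_cond big1 ?addr0 // => alpha /andP[/PhiP ra ab].
by rewrite kappa_ee ?opprK // ?(eq_sym beta) ?(negPf ab) ?scale0r //; apply: rootN.
Qed.

End Conjugation.

Lemma sigma_exists : exists sigma : L -> L,
  [/\ forall a x y, sigma (a *: x + y) = a^* *: sigma x + sigma y,
      forall i, sigma (hL (Delta i)) = - hL (Delta i)
    & forall alpha, is_root alpha -> sigma (e alpha) = - e (- alpha)].
Proof.
pose ws := [seq (hL (Delta i), - hL (Delta i)) | i <- enum 'I_n]
  ++ [seq (e alpha, - e (- alpha)) | alpha <- Phi].
have w1 : unzip1 ws = [seq hL (Delta i) | i <- enum 'I_n] ++ [seq e beta | beta <- Phi].
  by rewrite /unzip1 map_cat -!map_comp.
have [|sigma sP sE] := @antilinear_extension _ _ ws; first by rewrite w1.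
exists sigma; split=> // [i|alpha ra].
  by apply: (sE (_, _)); rewrite mem_cat map_f ?mem_enum.
by apply: (sE (_, _)); rewrite mem_cat orbC map_f //; apply/PhiP.
Qed.

(** In the [sl_2]-triple of [omega], the square of [E] has weight 4 and that of [f] has weight -4.
    Each action of [f] lowers the weight by 2, and four of them give the scalar [24]. *)
Lemma s2act4_lowest (V : {vspace sym2 L}) omega : is_root omega ->
  is_submodule (@s2act _ L) V -> s2mul (e omega) (e omega) \in V ->
  s2mul (e (- omega)) (e (- omega)) \in V.
Proof.
move=> ro Vsub eV; set f := e (- omega); set E := e omega; pose k := hL omega.
have rN := rootN ro.
have fE : lie f E = - k by rewrite lieC lie_eNe.
have fk : lie f k = 2 *: f.
  by rewrite lieC /k /f (e_root rN) hpairN coroot2 // scaleNr; exact: opprK.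
have ff : lie f f = 0 by rewrite liexx.
have a1 : s2act f (s2mul E E) = (-2) *: s2mul k E.
  by rewrite s2actE fE (s2mulC E) -s2mulDl -mulr2n -scaler_nat scalerN -scaleNr s2mulZl.
have a2 : s2act f (s2mul k E) = 2 *: s2mul f E - s2mul k k.
  by rewrite s2actE fE fk s2mulZl [s2mul k (- k)]s2mulC s2mulNl.
have a3 : s2act f (s2mul f E) = - s2mul f k.
  by rewrite s2actE ff fE s2mulC [s2mul f (- k)]s2mulC s2mulNl (s2mulC E)
    (linear_morph0 (s2mul_linearl E)) add0r s2mulC.
have a4 : s2act f (s2mul k k) = 4 *: s2mul f k.
  by rewrite s2actE fk (s2mulC k) -s2mulDl -scalerDl s2mulZl -natrD.
have a5 : s2act f (s2mul f k) = 2 *: s2mul f f.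
  by rewrite s2actE ff fk (linear_morph0 (s2mul_linearl k)) add0r s2mulC s2mulZl.
have a6 : s2act f (s2act f (s2act f (s2mul E E))) = 12 *: s2mul f k.
  rewrite a1 2!s2actZ a2 s2actD (linear_morphN (s2act_linear f)) s2actZ a3 a4.
  rewrite scalerN -scaleNr -[- (4 *: _)]scaleNr -scalerDl scalerA.
  by congr (_ *: _); ring.
have -> : s2mul f f = 24^-1 *: s2act f (s2act f (s2act f (s2act f (s2mul E E)))).
  rewrite a6 s2actZ a5 !scalerA.
  have -> : 24^-1 * (12 * 2) = 1 :> C; last by rewrite scale1r.
  by rewrite -natrM mulVf // pnatr_eq0.
by apply: memvZ; do 4 apply: (Vsub).
Qed.

Lemma generated_by_highest_cap (V : {vspace sym2 L}) omega : is_root omega ->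
  is_generated_submodule (@s2act _ L) (s2mul (e omega) (e omega)) V ->
  (forall r, r \in V -> r \in Aspace (@rescaled_killing C L c) V -> r = 0)
  /\ (forall u, (forall v, s2form (@rescaled_killing C L c) u v = 0) -> u = 0).
Proof.
move=> ro Vgen; have [sigma [sP sh se]] := sigma_exists.
have fr := frame_vectorsP sP sh se; split; last exact: (s2form_nondeg fr).
have [Vsub eV _] := Vgen.
apply: (generated_submodule_cap sP (sigma_lie sP sh se) (kappa_sigma sP sh se) fr Vgen).
(* The two signs from [sigma (e omega) = - e (- omega)] cancel in the square. *)
rewrite (s2conj_mul sP) se // s2mulNl s2mulC s2mulNl opprK.
exact: s2act4_lowest.
Qed.

End RootSystem.

Local Open Scope complex_scope.

Theorem proposition2p15 (R : realType) (L : lieAlgType R[i]) (hL : simple_lie L)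
  (T : ade) (n : nat) (hn : ade_rank T n)
  (H : {vspace L}) (hH : cartan_subalgebra H)
  (Delta : 'I_n -> hdual H) (hDelta : is_base Delta)
  (h : hdual H -> subvs_of H)
  (hh : forall alpha, is_root alpha -> is_coroot alpha (h alpha))
  (hT : forall i j : 'I_n,
      hpair (Delta j) (h (Delta i)) = (cartan_matrix T n i j)%:~R)
  (e : hdual H -> L) (he : is_chevalley_basis Delta h e)
  (omega : hdual H) (homega : is_highest_root Delta omega)
  (c : R[i])
  (hc : forall alpha, is_root alpha ->
      rescaled_killing c (vsval (h alpha)) (vsval (h alpha)) = 2)
  (V : {vspace sym2 L})
  (hV : is_generated_submodule (@s2act _ L) (s2mul (e omega) (e omega)) V) :
  let kappa : {symmetric L} := rescaled_killing c in
  let A : {vspace sym2 L} := Aspace kappa V in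
  is_submodule (@s2act _ L) A /\
  is_frobenius_algebra_for (subact (@s2act _ L) (U := A))
    (@Aprod _ L kappa V) (@Aform _ L kappa V).

Proof.
(* The rank bound provides the index of a simple root, on which [c_gt0] rests. *)
have n_gt0 : (0 < n)%N.
  by case: (T) hn => [n_ge|n_ge|/andP[n_ge _]]; apply: leq_trans _ n_ge.
have [[Phi [Phi_uniq PhiP basis]] e_root lie_eNe [N lie_ee]] := he.
have Cartan_real i j : hpair (Delta j) (h (Delta i)) \is Num.real.
  by rewrite hT realz.
have [lieH _ _] := hH; have [omega_root _] := homega; have [V_sub _ _] := hV.
move=> kappa A.
have [cap0 nondeg] := generated_by_highest_cap (Ordinal n_gt0) lieH hDelta hh
  Cartan_real Phi_uniq PhiP basis e_root lie_eNe lie_ee hc omega_root hV.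
have inv := @rescaled_killing_inv _ L c.
split; first exact: Aspace_submod.
exact: Aspace_frobenius.
Qed.
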